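(* Let $n\ge0$ and let $\sigma,\tau\in\mathrm{Typ}(n)$ be types of $n$. (1) The coefficient of $H_\tau$ in the expansion of $P_\sigma$ in the basis $\{H_\rho:\rho\in\mathrm{Typ}(n)\}$ is $\sum_{T\in\mathcal{PT}^{\mathrm{simp}}(\sigma,\tau)}(-1)^{\ell(\tau)-\ell(\sigma)}\,\mathfrak{L}(T)$. (2) The coefficient of $E_\tau$ in the expansion of $P_\sigma$ in the basis $\{E_\rho:\rho\in\mathrm{Typ}(n)\}$ is $\sum_{T\in\mathcal{PT}^{\mathrm{simp}}(\sigma,\tau)}(-1)^{\ell(\tau)}\,\mathfrak{L}(T)$.
   Context: A type of $n$ is a sequence $\tau=(\tau|^1,\tau|^2,\dots)$ of (possibly empty) integer partitions with $\sum_{i\ge1} i\,|\tau|^i|=n$, where $|\tau|^i|$ is the size of the partition $\tau|^i$; $\mathrm{Typ}(n)$ is the set of types of $n$. Its length is $\ell(\tau)=\sum_i\ell(\tau|^i)$, the total number of parts. Each part $d$ of $\tau|^r$ gives a block $d^r$ of $\tau$ (degree $d$, multiplicity $r$; not exponentiation). Let $x_{i,j}$ ($i,j\ge 1$) be indeterminates with $\deg x_{i,j}=i$; all series have rational coefficients. A monomial is square-free if every exponent is at most $1$. $H_d$ is the sum of all monomials of degree $d$; $E_d$ is the sum over square-free monomials $f$ of degree $d$ of $(-1)^{m(f)}f$, where $m(f)$ is the number of indeterminates in $f$; for $d\ge1$, $P_d=\sum_{k\mid d}\sum_{j\ge1}k\,x_{k,j}^{d/k}$. For $F\in\{H,E,P\}$,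 $F_{d^r}$ is obtained from $F_d$ by replacing each $x_{i,j}$ by $x_{i,j}^r$, and $F_\tau=\prod F_{d^r}$ over all blocks $d^r$ of $\tau$ (counted with repetition; empty product $=1$). It is known that $\{F_\tau\}_{\tau\in\mathrm{Typ}(n)}$ is, for each such $F$, a $\mathbb{Q}$-basis of the space $\mathrm{PSym}(n)$ of polysymmetric functions of degree $n$ (power series homogeneous of degree $n$ that are symmetric separately in each variable set $\{x_{i,j}\}_{j\ge1}$). The diagram of a partition $\lambda$ has left-justified rows of $\lambda_1,\lambda_2,\dots$ cells. A brick is a nonempty set of consecutive cells in one row; its length is its number of cells. A brick tabloid of shape $\lambda$ and content $\mu$ ($\lambda,\mu$ partitions) is a decomposition of the diagram of $\lambda$ into disjoint bricks whose multiset of lengths is the multiset of parts of $\mu$. A simple polybrick tabloid of shape $\sigma$ and content $\tau$ is a sequence $T=(T_i)_{i\ge1}$ where $T_i$ is a brick tabloid of shape $\sigma|^i$ and content $\tau|^i$ for each $i$. $\mathcal{PT}^{\mathrm{simp}}(\sigma,\tau)$ is the set of these. For $T$ in it, $\mathfrak{L}(T)$ is the product, over all rows of all $T_i$, of the length of the last (rightmost) brick in that row. *)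

(* Defs.v *)
From mathcomp Require Import all_boot all_order all_algebra.
From mathcomp Require Import finmap.
From mathcomp.multinomials Require Import monalg.

Set Implicit Arguments.
Unset Strict Implicit.
Unset Printing Implicit Defensive.

Import GRing.Theory.
Local Open Scope ring_scope.

(* The indeterminate x_{i,j}, i, j >= 1, is encoded by the pair (i.-1, j.-1). *)
Definition var : choiceType := (nat * nat)%type.
Definition vdeg (x : var) : nat := x.1.+1.

Notation monom := {cmonom var}.

Definition wdeg (m : monom) : nat := (\sum_(x <- finsupp m) vdeg x * m x)%N.
Definition squarefree (m : monom) : bool := all (fun x => m x <= 1)%N (finsupp m).

(* All monomials dividing m, each listed once: one for every vector of
   exponents a with a x <= m x for x in the support of m. *)
Definition mdivs (m : monom) : seq monom :=
  [seq [cmonom nat_of_ord (a x) | x : finsupp m]%M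
     | a : {dffun forall x : finsupp m, 'I_(m (val x)).+1}].

Lemma mdivs_cmE (m : monom) (a : {dffun forall x : finsupp m, 'I_(m (val x)).+1}) x :
  ([cmonom nat_of_ord (a y) | y : finsupp m]%M : monom) x =
  if insub x is Some y then a y : nat else 0%N.
Proof. by rewrite cmE /= fsfun_ffun; case: insub. Qed.

Lemma mem_mdivs (m a : monom) :
  reflect (exists b : monom, m = mmul a b) (a \in mdivs m).
Proof.
apply: (iffP imageP) => [[e _ ->]|[b ->]].
  set a' := [cmonom _ | _ : _]%M; exists (divcm m a').
  apply/eqP/cmP => x; rewrite cmM divcmE subnKC // mdivs_cmE.
  by case: insubP => [y _ <-|//]; rewrite -ltnS.
have lt_a (x : finsupp (mmul a b)) : (a (val x) < (mmul a b (val x)).+1)%N.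
  by rewrite cmM ltnS leq_addr.
exists [ffun x => Ordinal (lt_a x)] => //.
apply/eqP/cmP => x; rewrite mdivs_cmE; case: insubP => [y _ <-|].
  by rewrite ffunE.
by rewrite -cmE_eq0 cmM addn_eq0 => /andP[/eqP].
Qed.

Lemma mdivs_uniq (m : monom) : uniq (mdivs m).
Proof.
rewrite map_inj_uniq ?enum_uniq // => e1 e2 /eqP/cmP eq_e.
apply/ffunP => x; apply/val_inj; have := eq_e (val x).
by rewrite !mdivs_cmE valK.
Qed.

(* A formal power series over rat in the x_{i,j} is its family of coefficients. *)
Definition series : Type := monom -> rat.

Definition sone : series := fun m => (m == mone)%:R.
Definition smul (f g : series) : series :=
  fun m => \sum_(a <- mdivs m) f a * g (divcm m a).

(* The substitution x_{i,j} |-> x_{i,j}^r, r >= 1: each monomial a becomes a^r. *)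
Definition spow_subst (r : nat) (f : series) : series :=
  fun m => \sum_(a <- mdivs m | expcmn a r == m) f a.

Definition Hser (d : nat) : series := fun m => (wdeg m == d)%:R.

Definition Eser (d : nat) : series := fun m =>
  if (wdeg m == d) && squarefree m then (-1) ^+ #|` finsupp m| else 0.

(* The inner sum over j >= 1 may be restricted to the variables x_{k,j}
   occurring in m, as no other one contributes to the coefficient of m. *)
Definition Pser (d : nat) : series := fun m =>
  \sum_(k <- divisors d) \sum_(x <- finsupp m | vdeg x == k)
    if m == expcmn (ucm x) (d %/ k) then k%:R else 0.

Definition is_part (s : seq nat) : bool := sorted geq s && (0%N \notin s).

(* If tau is a type of n, then tau|^r is empty for r > n, and every tau|^r has
   at most n parts, all at most n; so Typ(n) is a finite type. The index i : 'I_n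
   stands for the multiplicity r = i.+1. *)
Definition is_type n (t : {ffun 'I_n -> n.-bseq 'I_n.+1}) : bool :=
  [forall i, is_part (map val (t i))]
  && (\sum_(i < n) i.+1 * sumn (map val (t i)) == n)%N.

Definition typ (n : nat) : finType :=
  {t : {ffun 'I_n -> n.-bseq 'I_n.+1} | is_type t}.

Definition tpart n (tau : typ n) (i : 'I_n) : seq nat := map val (val tau i).

Definition tlen n (tau : typ n) : nat := (\sum_(i < n) size (tpart tau i))%N.

Definition sertyp (F : nat -> series) n (tau : typ n) : series :=
  \big[smul/sone]_(i < n) \big[smul/sone]_(d <- tpart tau i)
    spow_subst i.+1 (F d).

Definition is_expansion n (B : typ n -> series) (f : series)
    (c : {ffun typ n -> rat}) : Prop :=
  forall m, f m = \sum_(rho : typ n) c rho * B rho m.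

(* Uniqueness of the expansion is part of the definition. *)
Definition is_coef n (B : typ n -> series) (f : series) (tau : typ n)
    (a : rat) : Prop :=
  exists2 c, unique (is_expansion B f) c & c tau = a.

(* Rows and columns are numbered from 0. *)
Definition cell (la : seq nat) : finType :=
  {i : 'I_(size la) & 'I_(nth 0%N la i)}.
Definition crow la (c : cell la) : nat := tag c.
Definition ccol la (c : cell la) : nat := tagged c.

Definition is_brick la (B : {set cell la}) : bool :=
  (B != set0) &&
  [exists i : 'I_(size la), exists a : 'I_(nth 0%N la i),
   exists b : 'I_(nth 0%N la i),
     B == [set c | (crow c == i) && (a <= ccol c <= b)%N]].

Definition brick_tabloids (la mu : seq nat) : {set {set {set cell la}}} :=
  [set T | [&& partition T [set: cell la], [forall B in T, is_brick B]
             & perm_eq [seq #|pred_of_set B| | B in T] mu]].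

Definition simple_polybrick_tabloids n (sigma tau : typ n) :=
  setXn (fun i : 'I_n => brick_tabloids (tpart sigma i) (tpart tau i)).

(* The rows of a partition are nonempty, so they correspond to their last
   cells c; the last brick of the row is then pblock T c. *)
Definition last_prod la (T : {set {set cell la}}) : nat :=
  (\prod_(c : cell la | (ccol c).+1 == nth 0 la (crow c)) #|pblock T c|)%N.

Definition poly_last_prod n (sigma : typ n)
    (T : {dffun forall i : 'I_n, {set {set cell (tpart sigma i)}}}) : nat :=
  (\prod_(i < n) last_prod (T i))%N.

(* Main.v *)
(* The generating series of H and E satisfy t H' = P H and t E' = - P E, that is,
   d H_d = sum_k P_k H_(d-k) and d E_d = - sum_k P_k E_(d-k); solving for P_d gives a
   sum over compositions of d weighted by the last part, i.e. over the decompositions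
   of a row of d cells into bricks, and multiplying over all blocks of sigma gives the
   sum over simple polybrick tabloids.
   Uniqueness of the expansions comes from the freeness of the P_sigma: the monomial
   prod x_(d,j)^r over the blocks d^r of sigma, with distinct j, occurs in P_rho only if
   rho = sigma, or rho has more blocks, or as many blocks with a larger sum of degrees.
   As P_sigma expands in the H_rho, which are no more numerous, these are free too, and
   likewise the E_rho. *)
From HB Require Import structures.
Require Import Defs.
From mathcomp Require Import all_boot all_order all_algebra finmap.
From mathcomp.multinomials Require Import monalg.
From mathcomp Require boolp.

Set Implicit Arguments.
Unset Strict Implicit.
Unset Printing Implicit Defensive.

Import Order.TTheory GRing.Theory Num.Theory.
Local Open Scope ring_scope.

Local Notation monom := {cmonom var}.

#[local] Arguments expcmn : simpl never.

(** One recurrence without signs, [p d = h d *+ d + \sum_j h j * p (d - j)], serves both parts: it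
    holds for [h = - H], [p = - P] and for [h = - E], [p = P]. Each block of [tau] then brings a
    sign, and in the first case so does each block of [sigma], whence the two different signs in the
    theorem. Blocks of multiplicity [r] obey the same recurrence because raising all variables to
    the power [r] is a ring morphism on series. Tabloids are sets of sets of cells, which offer no
    direct recursion. They are put in bijection with the bit vectors that mark where bricks start,
    and a row is summed by reading its bits from left to right. *)

Lemma big_pred1_seq (V : nmodType) (T : eqType) (s : seq T) (i : T) (P : pred T)
    (F : T -> V) :
  uniq s -> i \in s -> P =1 pred1 i -> \sum_(j <- s | P j) F j = F i.
Proof.
move=> s_uniq si Pi; rewrite (eq_bigl _ _ Pi) -big_filter filter_pred1_uniq //.
exact: big_seq1.
Qed.

(** * The ring of series *)

Lemma divcmK (m a : monom) : a \in mdivs m -> mmul a (divcm m a) = m.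
Proof.
by case/mem_mdivs=> b ->; apply/eqP/cmP=> x; rewrite cmM divcmE cmM addKn.
Qed.

Lemma mulKcm (a b : monom) : divcm (mmul a b) a = b.
Proof. by apply/eqP/cmP=> x; rewrite divcmE cmM addKn. Qed.

Lemma mem_mdivs_mul (a b : monom) : a \in mdivs (mmul a b).
Proof. by apply/mem_mdivs; exists b. Qed.

Lemma mem_mdivs_divcm (m a : monom) : a \in mdivs m -> divcm m a \in mdivs m.
Proof. by move=> am; rewrite -{2}(divcmK am) mulmC mem_mdivs_mul. Qed.

Lemma mmul_eq (m a b : monom) :
  (mmul a b == m) = (a \in mdivs m) && (b == divcm m a).
Proof.
apply/eqP/andP=> [<-|[am /eqP->]]; last exact: divcmK.
by rewrite mulKcm eqxx mem_mdivs_mul.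
Qed.

Lemma mdivs_trans (m a b : monom) :
  a \in mdivs m -> b \in mdivs a -> b \in mdivs m.
Proof.
case/mem_mdivs=> c -> /mem_mdivs[d ->]; rewrite -mulmA; exact: mem_mdivs_mul.
Qed.

Lemma mem_mdivs_refl (m : monom) : m \in mdivs m.
Proof. by apply/mem_mdivs; exists mone; rewrite mulm1. Qed.

Lemma mcoeff_sumU (K : choiceType) (G : zmodType) (s : seq K) (f : K -> G) a :
  uniq s -> (\sum_(b <- s) << f b *g b >>)@_a = if a \in s then f a else 0.
Proof.
move=> s_uniq; rewrite raddf_sum /=; case: ifP => [as_|/negbT a_s].
  rewrite (bigD1_seq a) //= mcoeffU eqxx mulr1n big1 ?addr0 // => b /negbTE ba.
  by rewrite mcoeffU ba.
rewrite big1_seq // => b /andP[_ bs]; rewrite mcoeffU.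
by case: eqP bs a_s => // -> ->.
Qed.

Section Convolution.
Variable R : comNzRingType.
Implicit Types (p q : {malg R[monom]}) (f g h : monom -> R) (m a : monom).

Definition convol f g m := \sum_(a <- mdivs m) f a * g (divcm m a).

Lemma mcoeffM_mdivs p q m : (p * q)@_m = convol (mcoeff^~ p) (mcoeff^~ q) m.
Proof.
pose dl := seq_fset tt (mdivs m).
(* The summation ranges are enlarged so that every divisor of [m] and every cofactor is an index;
   the indices added outside the supports have coefficient zero. *)
pose d1 := (msupp p `|` dl)%fset.
rewrite (@mcoeffMlw _ _ d1 (msupp q `|` [fset divcm m a | a in dl])%fset) ?fsubsetUl //.
transitivity (\sum_(k1 <- d1) if k1 \in mdivs m then p@_k1 * q@_(divcm m k1) else 0).
  apply: eq_bigr => k1 _; case: ifP => k1m; last first.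
    by rewrite big1 // => k2 _; rewrite mmul_eq k1m mulr0n.
  rewrite (bigD1_seq (divcm m k1)) ?fset_uniq //=; last first.
    by rewrite in_fsetU orbC in_imfset // seq_fsetE.
  rewrite mmul_eq k1m eqxx mulr1n big1 ?addr0 // => k2 /negbTE k2n.
  by rewrite mmul_eq k2n andbF mulr0n.
rewrite -big_mkcond -big_filter; apply: perm_big; apply: uniq_perm.
- by rewrite filter_uniq ?fset_uniq.
- exact: mdivs_uniq.
by move=> a; rewrite mem_filter in_fsetU seq_fsetE; case: (a \in mdivs m); rewrite ?orbT.
Qed.

Lemma ex_trunc m f :
  exists p : {malg R[monom]}, {in mdivs m, forall a, p@_a = f a}.
Proof.
exists (\sum_(a <- mdivs m) << f a *g a >>) => a am.
by rewrite mcoeff_sumU ?mdivs_uniq ?am.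
Qed.

(* Only the divisors of [m] matter for the coefficient of [m] in a product, so
   the ring laws for series are inherited from polynomials. *)
Lemma convol_trunc m f g p q :
    {in mdivs m, forall a, p@_a = f a} -> {in mdivs m, forall a, q@_a = g a} ->
  {in mdivs m, forall a, (p * q)@_a = convol f g a}.
Proof.
move=> pf qg a am; rewrite mcoeffM_mdivs; apply: eq_big_seq => b ba.
by rewrite pf ?qg // (mdivs_trans am) ?mem_mdivs_divcm.
Qed.

Lemma convolC f g m : convol f g m = convol g f m.
Proof.
have [[p pf] [q qg]] := (ex_trunc m f, ex_trunc m g).
rewrite -(convol_trunc pf qg (mem_mdivs_refl m)) mulrC.
exact: convol_trunc (mem_mdivs_refl m).
Qed.

Lemma convolA f g h m : convol f (convol g h) m = convol (convol f g) h m.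
Proof.
have [[[p pf] [q qg]] [r rh]] := (ex_trunc m f, ex_trunc m g, ex_trunc m h).
have mm := mem_mdivs_refl m.
rewrite -(convol_trunc pf (convol_trunc qg rh) mm) mulrA.
exact: convol_trunc (convol_trunc pf qg) rh _ mm.
Qed.

End Convolution.

Lemma smulC : commutative smul.
Proof. by move=> f g; apply: boolp.funext => m; apply: convolC. Qed.

Lemma smulA : associative smul.
Proof. by move=> f g h; apply: boolp.funext => m; apply: convolA. Qed.

Lemma smul1f : left_id sone smul.
Proof.
move=> f; apply: boolp.funext => m.
rewrite /smul (bigD1_seq mone) ?mdivs_uniq //=; last first.
  by apply/mem_mdivs; exists m; rewrite mul1m.
have divm1 : divcm m mone = m by rewrite -{1}[m]mul1m mulKcm.
rewrite /sone eqxx mul1r divm1 big1 ?addr0 // => a /negbTE ->; exact: mul0r.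
Qed.

Definition sadd (f g : series) : series := fun m => f m + g m.
Definition sopp (f : series) : series := fun m => - f m.
Definition szero : series := fun=> 0.

Lemma saddA : associative sadd.
Proof. by move=> f g h; apply: boolp.funext => m; apply: addrA. Qed.

Lemma saddC : commutative sadd.
Proof. by move=> f g; apply: boolp.funext => m; apply: addrC. Qed.

Lemma sadd0f : left_id szero sadd.
Proof. by move=> f; apply: boolp.funext => m; apply: add0r. Qed.

Lemma saddNf : left_inverse szero sopp sadd.
Proof. by move=> f; apply: boolp.funext => m; apply: addNr. Qed.

Lemma smulDl : left_distributive smul sadd.
Proof.
move=> f g h; apply: boolp.funext => m; rewrite /sadd /smul -big_split /=.
by apply: eq_bigr => a _; rewrite mulrDl.
Qed.

(** Series are functions on an infinite type, so the equality and choice structures come from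
    classical logic. The ring operations are [smul] and [sone] themselves, so the iterated products
    in [sertyp] are ring products by conversion. *)
HB.instance Definition _ := boolp.gen_eqMixin series.
HB.instance Definition _ := boolp.gen_choiceMixin series.
HB.instance Definition _ :=
  GRing.isZmodule.Build series saddA saddC sadd0f saddNf.
HB.instance Definition _ :=
  GRing.Zmodule_isComPzRing.Build series smulA smulC smul1f smulDl.

Lemma seriesD (f g : series) m : (f + g) m = f m + g m. Proof. by []. Qed.

Lemma seriesN (f : series) m : (- f) m = - f m. Proof. by []. Qed.

Lemma series_sum I (r : seq I) (P : pred I) (F : I -> series) m :
  (\sum_(i <- r | P i) F i) m = \sum_(i <- r | P i) F i m.
Proof. exact: (big_morph (fun f : series => f m)). Qed.

Lemma series_mulrn (f : series) k m : (f *+ k) m = f m *+ k.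
Proof. by elim: k => // k IHk; rewrite !mulrS seriesD IHk. Qed.

Lemma seriesM (f g : series) m :
  (f * g) m = \sum_(a <- mdivs m) f a * g (divcm m a).
Proof. by []. Qed.

(** * The substitution of r-th powers as a ring morphism *)

Lemma expcmE (a : monom) r x : expcmn a r x = (r * a x)%N.
Proof.
have expS k : expcmn a k.+1 = mmul a (expcmn a k).
  by case: k => [|k //]; rewrite /expcmn /= mulm1.
by elim: r => [|r IHr]; rewrite ?cm1 // expS cmM IHr mulSn.
Qed.

Lemma expcm_inj r : injective (fun a : monom => expcmn a r.+1).
Proof.
move=> a b /eqP/cmP ab; apply/eqP/cmP=> x; apply/eqP.
by have := ab x; rewrite !expcmE => /eqP; rewrite eqn_pmul2l.
Qed.

Lemma expcmM (a b : monom) r : expcmn (mmul a b) r = mmul (expcmn a r) (expcmn b r).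
Proof. by apply/eqP/cmP=> x; rewrite cmM !expcmE cmM mulnDr. Qed.

Lemma mem_mdivs_exp (a : monom) r : a \in mdivs (expcmn a r.+1).
Proof.
apply/mem_mdivs; exists (expcmn a r); apply/eqP/cmP=> x.
by rewrite cmM !expcmE mulSn.
Qed.

Lemma spow_subst_exp r f (a : monom) : spow_subst r.+1 f (expcmn a r.+1) = f a.
Proof.
rewrite /spow_subst (big_pred1_seq _ (mdivs_uniq _) (mem_mdivs_exp a r)) // => b.
exact: (inj_eq (@expcm_inj r)).
Qed.

Lemma spow_subst_nexp r f (m : monom) :
  (forall a, expcmn a r != m) -> spow_subst r f m = 0.
Proof. by move=> nexp; rewrite /spow_subst big_pred0 // => a; apply/negbTE. Qed.

Lemma spow_subst_is_zmod_morphism r : zmod_morphism (spow_subst r).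
Proof. by move=> f g; apply: boolp.funext => m; apply: sumrB. Qed.

Lemma spow_subst1 r : spow_subst r.+1 1 = 1.
Proof.
apply: boolp.funext => m; rewrite /spow_subst.
transitivity (\sum_(a <- mdivs m | a == mone) ((m == mone)%:R : rat)).
  rewrite big_mkcond [RHS]big_mkcond; apply: eq_bigr => a _.
  rewrite [X in if _ then X else _](_ : _ = (a == mone)%:R) //.
  have exp1 : expcmn (mone : monom) r.+1 = mone.
    by apply/eqP/cmP=> x; rewrite expcmE cm1 muln0.
  case: (eqVneq a mone) => [->|_]; first by rewrite exp1 eq_sym; case: eqP.
  by case: ifP.
have m1 : mone \in mdivs m by apply/mem_mdivs; exists m; rewrite mul1m.
by rewrite (big_pred1_seq _ (mdivs_uniq m) m1).
Qed.

(** If [m] is an r-th power [e^r], its divisors that are r-th powers are exactly the [b^r] with [b]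
    dividing [e], and the other divisors contribute zero. If [m] is not an r-th power, then in every
    factorisation of [m] one factor is not either. *)
Lemma spow_substM r f g :
  spow_subst r.+1 (f * g) = spow_subst r.+1 f * spow_subst r.+1 g.
Proof.
apply: boolp.funext => m; rewrite seriesM.
have [[e eqm]|nexp] := boolp.EM (exists e : monom, expcmn e r.+1 = m); last first.
  rewrite spow_subst_nexp => [|a]; last by apply/eqP => eqa; apply: nexp; exists a.
  rewrite big_seq big1 // => a am.
  have [[b eqb]|nb] := boolp.EM (exists b : monom, expcmn b r.+1 = a); last first.
    by rewrite spow_subst_nexp ?mul0r // => b; apply/eqP => eqb; apply: nb; exists b.
  rewrite [X in _ * X]spow_subst_nexp ?mulr0 // => c; apply/eqP => eqc.
  by apply: nexp; exists (mmul b c); rewrite expcmM eqb eqc divcmK.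
rewrite -eqm spow_subst_exp seriesM.
have divX (b c : monom) :
    divcm (expcmn b r.+1) (expcmn c r.+1) = expcmn (divcm b c) r.+1.
  by apply/eqP/cmP=> x; rewrite divcmE !expcmE divcmE mulnBr.
transitivity (\sum_(a <- [seq expcmn b r.+1 | b <- mdivs e])
    spow_subst r.+1 f a * spow_subst r.+1 g (divcm m a)).
  rewrite [RHS]big_map -eqm; apply: eq_bigr => b _.
  by rewrite divX !spow_subst_exp.
rewrite -eqm [RHS](bigID [in [seq expcmn b r.+1 | b <- mdivs e]]) /=.
rewrite [X in _ = _ + X]big_seq_cond [X in _ = _ + X]big1 => [|a /andP[am nae]].
  rewrite addr0 -[RHS]big_filter; apply: perm_big; apply: uniq_perm.
  - by rewrite map_inj_uniq ?mdivs_uniq //; apply: expcm_inj.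
  - by rewrite filter_uniq ?mdivs_uniq.
  move=> a; rewrite mem_filter; case: mapP => //= -[b be ->].
  by rewrite -(divcmK be) expcmM mem_mdivs_mul.
rewrite (@spow_subst_nexp r.+1 f) ?mul0r // => b; apply/eqP => eqb.
case/mapP: nae; exists b => //; apply/mem_mdivs; exists (divcm e b).
apply/eqP/cmP=> x; rewrite cmM divcmE subnKC //.
case/mem_mdivs: am => c /eqP/cmP/(_ x).
by rewrite -eqb cmM !expcmE => eqx; rewrite -(leq_pmul2l (ltn0Sn r)) eqx leq_addr.
Qed.

Lemma spow_subst_is_monoid_morphism r : monoid_morphism (spow_subst r.+1).
Proof. by split; [exact: spow_subst1 | exact: spow_substM]. Qed.

HB.instance Definition _ r := GRing.isZmodMorphism.Build series series
  (spow_subst r.+1) (spow_subst_is_zmod_morphism r.+1).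
HB.instance Definition _ r := GRing.isMonoidMorphism.Build series series
  (spow_subst r.+1) (spow_subst_is_monoid_morphism r).

(** * Newton identities *)

Lemma wdegEw (m : monom) (D : {fset var}) :
  (finsupp m `<=` D)%fset -> wdeg m = (\sum_(x <- D) vdeg x * m x)%N.
Proof.
move=> sub; rewrite /wdeg (big_fset_incl _ sub) // => x _.
by rewrite -cmE_eq0 => /eqP ->; rewrite muln0.
Qed.

Lemma wdegM (a b : monom) : wdeg (mmul a b) = (wdeg a + wdeg b)%N.
Proof.
have sub : (finsupp (mmul a b) `<=` finsupp a `|` finsupp b)%fset by rewrite mdomD.
rewrite (wdegEw sub) (wdegEw (fsubsetUl (finsupp a) (finsupp b))).
rewrite (wdegEw (fsubsetUr (finsupp a) (finsupp b))) -big_split /=.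
by apply: eq_bigr => x _; rewrite cmM mulnDr.
Qed.

Lemma wdeg_pow (x : var) e : wdeg (expcmn (ucm x) e) = (vdeg x * e)%N.
Proof.
rewrite (@wdegEw _ [fset x]%fset) ?big_seq_fset1 ?expcmE ?cmUU ?muln1 //.
apply/fsubsetP=> y; rewrite in_fset1 -cmE_neq0 expcmE cmU muln_eq0 negb_or.
by case/andP=> _; rewrite eqb0 negbK eq_sym.
Qed.

Lemma wdeg_eq0 (m : monom) : (wdeg m == 0%N) = (m == mone).
Proof.
apply/eqP/eqP=> [wm|->]; last by rewrite /wdeg mdom1 big_seq_fset0.
apply/eqP/cmP=> x; rewrite cm1; apply/eqP; rewrite cmE_eq0; apply/negP => xm.
by move: wm; rewrite /wdeg (big_fsetD1 x) //= => /eqP; rewrite addn_eq0 muln_eq0 cmE_eq0 xm.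
Qed.

(** A monomial determines its degree, so one function can hold the coefficients of
    [P_1 + P_2 + ...]; it vanishes at [mone]. *)
Definition Pcoef (a : monom) : rat :=
  \sum_(x <- finsupp a) if a == expcmn (ucm x) (a x) then (vdeg x)%:R else 0.

Lemma PserE k a : (0 < k)%N -> Pser k a = if wdeg a == k then Pcoef a else 0.
Proof.
move=> k_gt0; rewrite /Pser.
under eq_bigr do rewrite big_mkcond.
rewrite exchange_big /=.
transitivity (\sum_(x <- finsupp a)
    if (wdeg a == k) && (a == expcmn (ucm x) (a x)) then (vdeg x)%:R else 0 : rat).
  apply: eq_big_seq => x xa; rewrite -big_mkcond /=.
  have [vk|nvk] := boolP (vdeg x \in divisors k).
    rewrite (eq_bigl (pred1 (vdeg x))) => [|q]; last by rewrite /= eq_sym.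
    rewrite (big_pred1_seq _ (divisors_uniq k) vk) //.
    congr (if _ then _ else _); move: vk; rewrite -dvdn_divisors // => vk.
    apply/eqP/andP => [eqa|[/eqP wa /eqP eqa]].
      have ax : a x = (k %/ vdeg x)%N by rewrite eqa expcmE cmUU muln1.
      by rewrite ax -eqa eqxx {1}eqa wdeg_pow mulnC divnK.
    by rewrite -wa {2}eqa wdeg_pow mulKn.
  rewrite big1_seq; last by move=> q /andP[/eqP<-] vk; rewrite vk in nvk.
  case: ifP => // /andP[/eqP wa /eqP eqa]; case/negP: nvk.
  by rewrite -dvdn_divisors // -wa eqa wdeg_pow dvdn_mulr.
by case: eqP => _ /=; [by [] | rewrite big1].
Qed.

Definition hom_part (phi : monom -> rat) d : series :=
  fun m => if wdeg m == d then phi m else 0.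

Lemma leq_mdivs (m a : monom) x : a \in mdivs m -> (a x <= m x)%N.
Proof. by case/mem_mdivs=> b ->; rewrite cmM leq_addr. Qed.

(** The ranges of [x] and [e] depend on [m] alone, so these sums can be exchanged with a sum over
    the divisors [a] of [m]. *)
Lemma Pcoef_mdivs (m a : monom) : a \in mdivs m ->
  Pcoef a = \sum_(x <- finsupp m) \sum_(1 <= e < (m x).+1)
    if a == expcmn (ucm x) e then (vdeg x)%:R else 0.
Proof.
move=> am; transitivity (\sum_(x <- finsupp m)
    if (0 < a x)%N && (a == expcmn (ucm x) (a x)) then (vdeg x)%:R else 0 : rat).
  have sub : (finsupp a `<=` finsupp m)%fset.
    apply/fsubsetP=> x; rewrite -!cmE_neq0 -!lt0n => ax.
    exact: leq_trans ax (leq_mdivs x am).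
  rewrite /Pcoef -(big_fset_incl _ sub) => [|x _].
    by apply: eq_big_seq => x; rewrite -cmE_neq0 -lt0n => ->.
  by rewrite -cmE_eq0 => /eqP ->.
apply: eq_bigr => x _.
transitivity (\sum_(1 <= e < (m x).+1 | e == a x)
    if a == expcmn (ucm x) (a x) then (vdeg x)%:R else 0 : rat).
  by rewrite big_nat1_eq ltnS (leq_mdivs x am) andbT; case: (0 < a x)%N.
rewrite big_mkcond; apply: eq_bigr => e _.
case: (eqVneq e) => [-> //|ne]; case: eqP => // eqa; case/eqP: ne.
by rewrite eqa expcmE cmUU muln1.
Qed.

(** The monomials of the [P_k] are powers of one variable, so multiplying by them amounts to
    removing a power [x^e], [e >= 1], from [m] in every possible way. Both Newton identities thereby
    become computations at each single variable of [m]. *)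
Lemma P_convolution phi d :
  \sum_(1 <= k < d.+1) Pser k * hom_part phi (d - k)%N =
  hom_part (fun m => \sum_(x <- finsupp m) \sum_(1 <= e < (m x).+1)
              (vdeg x)%:R * phi (divcm m (expcmn (ucm x) e))) d.
Proof.
apply: boolp.funext => m; rewrite series_sum.
under eq_bigr do rewrite seriesM.
rewrite exchange_big /=.
transitivity (\sum_(a <- mdivs m)
    if wdeg m == d then Pcoef a * phi (divcm m a) else 0).
  apply: eq_big_seq => a am.
  have wm : wdeg m = (wdeg a + wdeg (divcm m a))%N by rewrite -wdegM divcmK.
  transitivity (\sum_(1 <= k < d.+1 | k == wdeg a)
      Pcoef a * hom_part phi (d - wdeg a)%N (divcm m a)).
    rewrite [RHS]big_mkcond; apply: eq_big_nat => k /andP[k_gt0 _].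
    by rewrite PserE // eq_sym; case: eqP => [->|_]; rewrite ?mul0r.
  (* The range of [k] starts at 1 and so misses the divisor [mone], where [Pcoef] is zero anyway. *)
  rewrite big_nat1_eq ltnS lt0n wdeg_eq0; case: (eqVneq a mone) => [->|_] /=.
    by rewrite /Pcoef mdom1 big_seq_fset0 mul0r if_same.
  rewrite /hom_part wm; case: leqP => [le_ad|lt_da].
    rewrite -(eqn_add2l (wdeg a)) subnKC //; case: eqP => // _.
    exact: mulr0.
  by case: eqP => // eqd; rewrite -eqd ltnNge leq_addr in lt_da.
rewrite /hom_part; case: eqP => _; last by rewrite big1.
transitivity (\sum_(a <- mdivs m) \sum_(x <- finsupp m) \sum_(1 <= e < (m x).+1)
    if a == expcmn (ucm x) e then (vdeg x)%:R * phi (divcm m a) else 0 : rat).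
  apply: eq_big_seq => a am; rewrite (Pcoef_mdivs am) mulr_suml.
  apply: eq_bigr => x _; rewrite mulr_suml; apply: eq_bigr => e _.
  by case: ifP => _; rewrite ?mul0r.
rewrite exchange_big /=; apply: eq_bigr => x _; rewrite exchange_big /=.
apply: eq_big_nat => e /andP[_ lt_em]; rewrite -big_mkcond.
rewrite (@big_pred1_seq _ _ _ (expcmn (ucm x) e)) ?mdivs_uniq //; apply/mem_mdivs.
exists (divcm m (expcmn (ucm x) e)); apply/eqP/cmP=> y.
rewrite cmM divcmE expcmE subnKC // cmU; case: eqP => [<-|_]; last by rewrite muln0.
by rewrite muln1 -ltnS.
Qed.

Lemma natr_wdeg (m : monom) :
  (wdeg m)%:R = \sum_(x <- finsupp m) (vdeg x)%:R * (m x)%:R :> rat.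
Proof. by rewrite natr_sum; apply: eq_bigr => x _; rewrite natrM. Qed.

(** Each variable [x] of [m] can be removed with [m x] different exponents, each weighted by
    [vdeg x]; the total is the degree of [m]. *)
Lemma newton_H d : Hser d *+ d = \sum_(1 <= k < d.+1) Pser k * Hser (d - k)%N.
Proof.
have HserE k : Hser k = hom_part (fun=> 1) k.
  by apply: boolp.funext => m; rewrite /Hser /hom_part; case: eqP.
under eq_bigr do rewrite HserE.
rewrite P_convolution; apply: boolp.funext => m.
rewrite series_mulrn /Hser /hom_part; case: eqP => [<-|_]; last exact: mul0rn.
rewrite natr_wdeg; apply: eq_bigr => x _.
by rewrite sumr_const_nat subn1 mulr1 mulr_natr.
Qed.

Definition Ecoef (m : monom) : rat :=
  if squarefree m then (-1) ^+ #|` finsupp m| else 0.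

Lemma squarefreeP (m : monom) : reflect (forall x, m x <= 1)%N (squarefree m).
Proof.
apply: (iffP allP) => [sq x|sq x _]; last exact: sq.
by case: (mdomP m x) => // xm; apply: sq.
Qed.

Lemma finsupp_divU (m : monom) x : m x = 1%N ->
  finsupp (divcm m (ucm x)) = (finsupp m `\ x)%fset.
Proof.
move=> mx; apply/fsetP=> y; rewrite in_fsetD1 -!cmE_neq0 divcmE cmU (eq_sym x).
by case: (eqVneq y x) => [->|_] /=; rewrite ?mx ?subnn // subn0.
Qed.

(** When [m x >= 2], only the quotients that keep [x] with exponent 1 or 0 can be square-free. They
    are square-free together and differ by one variable, so their signs cancel. *)
Lemma Ecoef_pow (m : monom) x : x \in finsupp m ->
  \sum_(1 <= e < (m x).+1) Ecoef (divcm m (expcmn (ucm x) e)) =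
  if m x == 1%N then Ecoef (divcm m (ucm x)) else 0.
Proof.
rewrite -cmE_neq0 -lt0n => mx_gt0.
have div_x e : divcm m (expcmn (ucm x) e) x = (m x - e)%N.
  by rewrite divcmE expcmE cmUU muln1.
have div_nx e y : y != x -> divcm m (expcmn (ucm x) e) y = m y.
  by rewrite divcmE expcmE cmU eq_sym => /negbTE ->; rewrite muln0 subn0.
case: eqP => [->|/eqP mx_neq1]; first by rewrite big_nat1.
have [k mx] : exists k, m x = k.+2.
  by case: (m x) mx_gt0 mx_neq1 => [|[|k]] // _ _; exists k.
rewrite mx big_nat_recr //= big_nat_recr //= big_nat big1 => [|e /andP[e1 ek]].
  rewrite add0r /Ecoef.
  set a := divcm m (expcmn _ k.+1); set b := divcm m (expcmn _ k.+2).
  have ax : a x = 1%N by rewrite div_x mx subSnn.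
  have -> : b = divcm a (ucm x).
    apply/eqP/cmP=> y; rewrite /b [in RHS]divcmE cmU; case: (eqVneq x y) => [<-|nyx].
      by rewrite ax div_x mx subnn.
    by rewrite subn0 !div_nx // eq_sym.
  have sq_ab : squarefree (divcm a (ucm x)) = squarefree a.
    apply/squarefreeP/squarefreeP => sq y.
      by have := sq y; rewrite divcmE cmU; case: eqP => [<-|]; rewrite ?ax ?subn0.
    by rewrite divcmE (leq_trans (leq_subr _ _)).
  rewrite sq_ab finsupp_divU //; case: ifP => _; last by rewrite addr0.
  rewrite (cardfsD1 x (finsupp a)) -cmE_neq0 ax exprS mulN1r addNr //.
rewrite /Ecoef; case: squarefreeP => // /(_ x).
by rewrite div_x mx (subSn (ltnW ek)) ltnS leqn0 subn_eq0 leqNgt ek.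
Qed.

(** Only variables of exponent 1 survive by [Ecoef_pow]. Removing one of them preserves
    square-freeness or its failure and flips the sign, so each contributes [vdeg x] times the
    coefficient of [m]. *)
Lemma newton_E d : Eser d *+ d = - \sum_(1 <= k < d.+1) Pser k * Eser (d - k)%N.
Proof.
have EserE k : Eser k = hom_part Ecoef k.
  by apply: boolp.funext => m; rewrite /Eser /hom_part /Ecoef; case: eqP.
under eq_bigr do rewrite EserE.
rewrite P_convolution; apply: boolp.funext => m.
rewrite series_mulrn seriesN EserE /hom_part.
case: eqP => [<-|_]; last by rewrite oppr0 mul0rn.
transitivity (- \sum_(x <- finsupp m)
    (vdeg x)%:R * if m x == 1%N then Ecoef (divcm m (ucm x)) else 0 : rat); last first.
  by congr (- _); apply: eq_big_seq => x xm; rewrite -Ecoef_pow // mulr_sumr.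
rewrite -sumrN -mulr_natr natr_wdeg mulr_sumr; apply: eq_big_seq => x xm.
case: eqP => mx; last first.
  rewrite mulr0 oppr0 /Ecoef; case: squarefreeP => [sq|_]; last by rewrite mul0r.
  by case: mx; apply/eqP; rewrite eqn_leq sq lt0n cmE_neq0.
rewrite mx mulr1 mulrC -mulrN; congr (_ * _); rewrite /Ecoef.
have -> : squarefree (divcm m (ucm x)) = squarefree m.
  apply/squarefreeP/squarefreeP => sq y.
    by have := sq y; rewrite divcmE cmU; case: eqP => [<-|]; rewrite ?mx ?subn0.
  by rewrite divcmE (leq_trans (leq_subr _ _)).
rewrite finsupp_divU //; case: ifP => _; last by rewrite oppr0.
by rewrite (cardfsD1 x (finsupp m)) xm exprS mulN1r.
Qed.

(** * Bricks in a row *)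

Lemma bigA_distr_dffun (R : comPzSemiRingType) (I : finType) (T : I -> finType)
    (Q : forall i, pred (T i)) (F : forall i, T i -> R) :
  \prod_i \sum_(j : T i | Q i j) F i j =
  \sum_(f : {dffun forall i, T i} | [forall i, Q i (f i)]) \prod_i F i (f i).
Proof.
(* The predicate is absorbed into the summand, extended by zero, so that only sums over full types
   are distributed. *)
pose G i := [ffun j : T i => if Q i j then F i j else 0].
transitivity (\sum_(f : {dffun forall i, T i}) \prod_i G i (f i)).
  rewrite (reindex (@dffun_of_fprod _ T)) /=; last exact/onW_bij/dffun_of_fprod_bij.
  transitivity (\sum_(t : fprod T) \prod_(i in I) G i (t i)); last first.
    by apply: eq_bigr => t _; apply: eq_bigr => i _; rewrite [dffun_of_fprod t i]ffunE.
  rewrite big_fprod -(bigA_distr_big_dep (tagged_with T) (fun i => untag 0 (G i))).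
  apply: eq_bigr => i _; rewrite -(big_tag (fun i (j : T i) => G i j)) big_mkcond.
  by apply: eq_bigr => j _; rewrite ffunE.
rewrite [RHS]big_mkcond; apply: eq_bigr => f _.
case: forallP => [Qf|nQf]; first by apply: eq_bigr => i _; rewrite ffunE Qf.
have [i nQi] : exists i, ~~ Q i (f i).
  by apply/existsP; rewrite -negb_forall; apply/forallP.
by rewrite (bigD1 i) //= ffunE (negbTE nQi) mul0r.
Qed.

Lemma big_tuple_cons (V : nmodType) (T : finType) m (F : m.+1.-tuple T -> V) :
  \sum_t F t = \sum_x \sum_(t : m.-tuple T) F [tuple of x :: t].
Proof.
rewrite pair_bigA (reindex (fun q : T * m.-tuple T => [tuple of q.1 :: q.2])) //=.
exists (fun t : m.+1.-tuple T => (thead t, [tuple of behead t])) => [[x t] _|t _].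
  by rewrite /= theadE; congr pair; apply: val_inj.
by rewrite /= -tuple_eta.
Qed.

(* [st D c] is the first cell of the brick containing cell [c], in a row where the
   bricks start at cell [0] and at the cells selected by [D]; [len D d a] is the
   length of the brick starting at [a] when the row has [d] cells. *)
Fixpoint st (D : pred nat) c : nat :=
  if c is c'.+1 then if D c then c else st D c' else 0.

Definition len (D : pred nat) d a : nat := \sum_(c < d) (st D c == a).

Lemma st_le D c : (st D c <= c)%N.
Proof. by elim: c => //= c IHc; case: ifP => // _; apply: leq_trans IHc _. Qed.

Lemma st_cut (D : pred nat) c : D 0%N -> D (st D c).
Proof. by move=> D0; elim: c => //= c IHc; case: ifP. Qed.

Lemma st_fix (D : pred nat) c : D c -> st D c = c.
Proof. by case: c => //= c ->. Qed.

Lemma st_homo D : {homo st D : a b / (a <= b)%N}.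
Proof.
move=> a b; elim: b => [|b IHb]; first by rewrite leqn0 => /eqP ->.
rewrite leq_eqVlt => /predU1P[->//|le_ab]; apply: leq_trans (IHb le_ab) _ => /=.
by case: ifP => // _; apply: leq_trans (st_le D b) _.
Qed.

Lemma len_gt D d a : (d <= a)%N -> len D d a = 0%N.
Proof.
move=> le_da; apply: big1 => c _; case: eqP => // eqa.
by have := leq_ltn_trans (st_le D c) (ltn_ord c); rewrite eqa ltnNge le_da.
Qed.

(** Cell [0] always starts a brick, so a row of [d] cells is described by [d.-1] bits, and bit
    [a.-1] belongs to cell [a]. *)
Definition cut m (t : m.-tuple bool) : pred nat :=
  fun a => (a == 0%N) || nth false t a.-1.

Section Row.
Variables (R : comPzRingType) (h p : nat -> R).
Hypothesis p_rec : forall d, (0 < d)%N ->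
  p d = h d *+ d + \sum_(1 <= j < d) h j * p (d - j)%N.

(* Scanning a row from left to right: the weight of the completed bricks and the
   length of the current one; the bit tells whether the next cell starts a brick. *)
Definition scan (s : R * nat) (b : bool) : R * nat :=
  if b then (s.1 * h s.2, 1%N) else (s.1, s.2.+1).

Definition scan_weight (s : R * nat) : R := s.1 * (h s.2 *+ s.2).

(** The index [j] is the number of further cells that the current brick takes before a new one
    starts; what remains is a fresh row of [m - j] cells, which sums to [p (m - j)]. The first term
    is the case where the current brick fills the row. *)
Lemma sum_scan m s :
  \sum_(t : m.-tuple bool) scan_weight (foldl scan s t) =
  s.1 * (h (s.2 + m)%N *+ (s.2 + m) + \sum_(j < m) h (s.2 + j)%N * p (m - j)%N).
Proof.
elim: m s => [|m IHm] [u k].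
  rewrite (big_pred1 [tuple]) => [|t]; last by apply/esym/eqP; rewrite [t]tuple0.
  by rewrite big_ord0 addr0 addn0.
(* After a cut, the state with current length 1 and [m] cells to read is a fresh row of [m.+1]
   cells. *)
have pS : h (1 + m)%N *+ (1 + m) + \sum_(j < m) h (1 + j)%N * p (m - j)%N = p m.+1.
  by rewrite p_rec // big_add1 big_mkord.
rewrite big_tuple_cons big_bool /= !IHm /= pS big_ord_recl addn0 subn0 addSnnS.
rewrite -mulrA -mulrDr addrCA; congr (_ * (_ + (_ + _))).
by apply: eq_bigr => j _; rewrite lift0 addSnnS subSS.
Qed.

(** Invariant of the scan after the first [m.+1] cells: the completed bricks are those starting at
    cuts other than [st D m], where the current brick starts. *)
Lemma foldl_scan (D : pred nat) m : D 0%N ->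
  foldl scan (1, 1%N) [seq D i.+1 | i <- iota 0 m] =
  (\prod_(a < m.+1 | D a && (nat_of_ord a != st D m)) h (len D m.+1 a),
   len D m.+1 (st D m)).
Proof.
move=> D0; elim: m => [|m IHm].
  rewrite /= /len big1 => [|a]; last by rewrite ord1 andbF.
  by rewrite big_ord1.
have -> : iota 0 m.+1 = rcons (iota 0 m) m by rewrite -addn1 iotaD cats1.
rewrite map_rcons foldl_rcons {}IHm {1}/scan.
have lenS a : len D m.+2 a = (len D m.+1 a + (st D m.+1 == a))%N.
  by rewrite /len big_ord_recr.
have le_st := st_le D m.
case: ifP => Dm; congr pair.
(* A cut at [m.+1] completes the brick that starts at [st D m]: its factor enters the product, while
   the new cell, now the start of the current brick, stays out. *)
- rewrite /= [RHS]big_mkcond big_ord_recr /= Dm eqxx andbF mulr1.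
  rewrite [RHS](bigD1 (Ordinal (le_st : (st D m < m.+1)%N))) //= [LHS]mulrC.
  rewrite st_cut // lenS /= Dm ltn_eqF ?ltnS // gtn_eqF ?ltnS // addn0.
  congr (_ * _); rewrite [LHS]big_mkcond [RHS]big_mkcond; apply: eq_bigr => a _.
  rewrite -val_eqE /= lenS /= Dm (gtn_eqF (ltn_ord a)) (ltn_eqF (ltn_ord a)) addn0 andbT.
  by case: (nat_of_ord a != st D m); rewrite ?andbT ?andbF.
- by rewrite /= lenS /= Dm eqxx len_gt.
- rewrite /= [LHS]big_mkcond [RHS]big_mkcond [RHS]big_ord_recr /= Dm mulr1.
  apply: eq_bigr => a _; rewrite lenS /= Dm eq_sym.
  by case: eqP => [|_]; rewrite ?andbF // addn0.
by rewrite /= lenS /= Dm eqxx addn1.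
Qed.

Lemma row_weight (D : pred nat) m : D 0%N ->
  (\prod_(a < m.+1 | D a) h (len D m.+1 a)) *+ len D m.+1 (st D m) =
  scan_weight (foldl scan (1, 1%N) [seq D i.+1 | i <- iota 0 m]).
Proof.
move=> D0; rewrite foldl_scan // /scan_weight /= mulrnAr.
rewrite (bigD1 (Ordinal (st_le D m : (st D m < m.+1)%N))) /= ?st_cut //.
by rewrite mulrC.
Qed.

Lemma row_sum d : (0 < d)%N ->
  \sum_(t : d.-1.-tuple bool)
    (\prod_(a < d | cut t a) h (len (cut t) d a)) *+ len (cut t) d (st (cut t) d.-1)
  = p d.
Proof.
case: d => // d _ /=.
transitivity (\sum_(t : d.-tuple bool) scan_weight (foldl scan (1, 1%N) t)).
  apply: eq_bigr => t _; rewrite row_weight //; congr (scan_weight (foldl _ _ _)).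
  by rewrite -[RHS](mkseq_nth false) size_tuple.
rewrite sum_scan p_rec // mul1r; congr (_ + _); rewrite big_add1 big_mkord.
by apply: eq_bigr => j _; rewrite subSS.
Qed.

End Row.

(** * Brick tabloids *)

Section Tabloids.
Variable la : seq nat.
Hypothesis la_pos : 0%N \notin la.
Local Notation cell := (cell la).
Local Notation row_len i := (nth 0%N la i).

(** All contents together: only the sum over all of them factors over the rows. *)
Definition tabloids : {set {set {set cell}}} :=
  [set T | partition T [set: cell] && [forall B in T, is_brick B]].

Definition cuts := {dffun forall i : 'I_(size la), (row_len i).-1.-tuple bool}.

Lemma row_len_gt0 (i : 'I_(size la)) : (0 < row_len i)%N.
Proof. by rewrite lt0n; apply: contraNneq la_pos => <-; rewrite mem_nth. Qed.

Lemma cell_inj (c c' : cell) : tag c = tag c' -> ccol c = ccol c' -> c = c'.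
Proof.
case: c c' => [i j] [i' j']; rewrite /ccol /= => eqi; case: i' / eqi j' => j' eqj.
by congr Tagged; apply: val_inj.
Qed.

Lemma ccol_lt (c : cell) : (ccol c < row_len (tag c))%N.
Proof. exact: ltn_ord. Qed.

Definition mkcell (i : 'I_(size la)) k (lt_k : (k < row_len i)%N) : cell :=
  Tagged (fun i : 'I_(size la) => 'I_(row_len i)) (Ordinal lt_k).

Definition brick_start (D : cuts) (c : cell) : nat := st (cut (D (tag c))) (ccol c).

Definition same_brick (D : cuts) (c c' : cell) : bool :=
  (tag c == tag c') && (brick_start D c == brick_start D c').

Definition tabloid_of (D : cuts) : {set {set cell}} :=
  equivalence_partition (same_brick D) [set: cell].

(** Quantifying over cells, which are determined by row and column, avoids constructing the cells
    [k] and [k.+1] of row [i] with proofs of their bounds. *)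
Definition cut_between (T : {set {set cell}}) (i : 'I_(size la)) k : bool :=
  [exists c : cell, exists c' : cell,
     [&& tag c == i, ccol c == k, tag c' == i, ccol c' == k.+1 & c' \notin pblock T c]].

Definition cuts_of (T : {set {set cell}}) : cuts :=
  [ffun i : 'I_(size la) =>
     (mktuple (fun k : 'I_(row_len i).-1 => cut_between T i k)
       : (row_len i).-1.-tuple bool)].

Lemma same_brick_equiv D : {in [set: cell] & &, equivalence_rel (same_brick D)}.
Proof.
move=> x y z _ _ _; rewrite /same_brick !eqxx; split=> // /andP[/eqP -> /eqP ->].
by [].
Qed.

Lemma mem_pblock_tabloid_of D c c' :
  (c' \in pblock (tabloid_of D) c) = same_brick D c c'.
Proof. by rewrite pblock_equivalence_partition ?inE //; apply: same_brick_equiv. Qed.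

Lemma tabloid_of_partition D : partition (tabloid_of D) [set: cell].
Proof. by apply: equivalence_partitionP; apply: same_brick_equiv. Qed.

(** The blocks are, within a row, the fibres of the monotone map [st], hence intervals: from the
    common start to the last column with that start. *)
Lemma tabloid_of_brick D : tabloid_of D \in tabloids.
Proof.
have partD := tabloid_of_partition D; rewrite inE partD /=.
have [/eqP covD tiD n0D] := and3P partD.
apply/forall_inP => B BD.
have /set0Pn[c cB] : B != set0 by apply: contraNneq n0D => <-.
rewrite -(def_pblock tiD BD cB) /is_brick.
have cc : c \in pblock (tabloid_of D) c by rewrite mem_pblock covD inE.
apply/andP; split; first by apply/set0Pn; exists c.
pose C := cut (D (tag c)); pose s := st C (ccol c).
have s_lt : (s < row_len (tag c))%N := leq_ltn_trans (st_le C _) (ccol_lt c).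
pose b0 : 'I_(row_len (tag c)) := tagged c.
apply/existsP; exists (tag c); apply/existsP; exists (Ordinal s_lt); apply/existsP.
case: (@arg_maxnP _ b0 (fun b => st C b == s) (fun b => nat_of_ord b) (eqxx _)) => b.
move=> /eqP stb bmax; exists b; apply/eqP/setP => c'.
rewrite mem_pblock_tabloid_of inE /same_brick /crow -val_eqE eq_sym /=.
case: (eqVneq (tag c') (tag c)) => [eqt|ne]; last by rewrite val_eqE (negbTE ne).
rewrite eqt eqxx /=; rewrite /brick_start -/C eqt -/C -/s.
apply/eqP/andP => [eqs|[le_sc le_cb]].
  split; first by rewrite eqs st_le.
  have lt_c' : (ccol c' < row_len (tag c))%N by rewrite -eqt ccol_lt.
  by apply: (bmax (Ordinal lt_c')); rewrite /= -eqs.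
apply/eqP; rewrite eqn_leq -{1}[s](@st_fix C) ?st_cut // st_homo //=.
by rewrite -stb st_homo.
Qed.

Lemma mem_tabloid_pblock T c : T \in tabloids -> exists a b, forall c',
  (c' \in pblock T c) = [&& tag c' == tag c, a <= ccol c' & ccol c' <= b]%N.
Proof.
rewrite inE => /andP[/and3P[/eqP covT tiT n0T] /forall_inP brT].
have cc : c \in pblock T c by rewrite mem_pblock covT inE.
have /brT/andP[_ /existsP[i /existsP[a /existsP[b /eqP eqB]]]] : pblock T c \in T.
  by rewrite pblock_mem // covT inE.
move: cc; rewrite eqB inE => /andP[/eqP eqi _]; exists a, b => c'.
by rewrite inE; congr (_ && _); rewrite -eqi val_eqE.
Qed.

Lemma cut_cuts_of T (c c' : cell) : tag c = tag c' -> ccol c' = (ccol c).+1 ->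
  cut (cuts_of T (tag c)) (ccol c') = (c' \notin pblock T c).
Proof.
move=> eqt eqc; rewrite /cut eqc /= ffunE.
have lt_c : (ccol c < (row_len (tag c)).-1)%N.
  by have := ccol_lt c'; rewrite -eqt eqc; case: (row_len _).
rewrite -[X in nth _ _ X]/(nat_of_ord (Ordinal lt_c)) nth_mktuple.
apply/existsP/idP => [[d /existsP[d' /and5P[/eqP td /eqP cd /eqP td' /eqP cd']]]|nin].
  by rewrite (@cell_inj d c) // (@cell_inj d' c') ?cd' ?eqc // td' eqt.
by exists c; apply/existsP; exists c'; rewrite -eqt eqc !eqxx.
Qed.

(** Induction on the column of the right-hand cell [c'], comparing it with its left neighbour.
    Without a cut between these two, they share a brick and a start, and the induction hypothesis
    applies. *)
Lemma same_brick_cuts_of T c c' : T \in tabloids ->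
  (c' \in pblock T c) = same_brick (cuts_of T) c c'.
Proof.
move=> TT; have [/and3P[/eqP covT tiT _] _] := andP (etrans (esym (in_set _ _)) TT).
have symT x y : (y \in pblock T x) = (x \in pblock T y).
  have mem_self z : z \in pblock T z by rewrite mem_pblock covT inE.
  by apply/idP/idP => /(same_pblock tiT) ->.
have eqT x y : y \in pblock T x -> pblock T y = pblock T x.
  exact: same_pblock.
wlog le_c : c c' / (ccol c <= ccol c')%N.
  move=> wlog_c; case: (leqP (ccol c) (ccol c')) => [|/ltnW]; first exact: wlog_c.
  move/wlog_c; rewrite symT => ->; rewrite /same_brick eq_sym.
  by rewrite [X in _ && X]eq_sym.
case: (eqVneq (tag c) (tag c')) => [eqt|ne]; last first.
  rewrite /same_brick (negbTE ne).
  have [a [b ->]] := mem_tabloid_pblock c TT.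
  by rewrite eq_sym (negbTE ne).
rewrite /same_brick eqt eqxx /= /brick_start eqt.
have [l eql] : exists l, ccol c' = l by exists (ccol c').
elim: l c' eql le_c eqt => [|l IHl] c' eql le_c eqt.
  rewrite (@cell_inj c c') //; first by rewrite eqxx mem_pblock covT inE.
  by apply/eqP; rewrite eql -leqn0 -eql.
move: le_c; rewrite leq_eqVlt => /predU1P[eqc|].
  by rewrite (@cell_inj c c') // eqxx mem_pblock covT inE.
rewrite eql ltnS => le_cl.
have lt_l : (l < row_len (tag c'))%N by rewrite -ltnS -eql ltnW // ltnS ccol_lt.
have IH := IHl (mkcell lt_l) (erefl _) le_cl eqt.
have /= cutP := @cut_cuts_of T (mkcell lt_l) c' (erefl _) eql.
rewrite eql in cutP; rewrite /= cutP.
case: ifPn => [nin|]; last by rewrite negbK => /eqT eqT'; rewrite symT eqT' -symT.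
(* With a cut at [c'], its start lies beyond that of [c]. A brick containing both [c] and [c'] would
   be an interval, so it would contain the left neighbour of [c'], against the cut. *)
rewrite [RHS]ltn_eqF ?ltnS ?(leq_trans (st_le _ _)) //.
apply/negP => c'c; case/negP: nin.
suff lc : mkcell lt_l \in pblock T c by rewrite (eqT _ _ lc).
have [a [b mem_c]] := mem_tabloid_pblock c TT.
have cc : c \in pblock T c by rewrite mem_pblock covT inE.
move: cc c'c; rewrite !mem_c eqxx /= => /andP[le_ac _] /and3P[_ _ le_lb].
rewrite eq_sym eqt eqxx (leq_trans le_ac le_cl) /=.
by rewrite (leq_trans _ le_lb) // eql.
Qed.

Lemma cuts_ofK : {in tabloids, cancel cuts_of tabloid_of}.
Proof.
move=> T TT; have := TT; rewrite inE => /andP[partT _].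
rewrite -[RHS](equivalence_partition_pblock partT) /tabloid_of.
by apply: eq_imset => c; apply/setP => c'; rewrite !inE same_brick_cuts_of.
Qed.

Lemma tabloid_ofK : cancel tabloid_of cuts_of.
Proof.
move=> D; apply/ffunP => i; apply/eq_from_tnth => k; rewrite !(tnth_nth false).
have lt_k1 : (k.+1 < row_len i)%N by rewrite -ltn_predRL.
have := @cut_cuts_of (tabloid_of D) (mkcell (ltnW lt_k1)) (mkcell lt_k1)
  (erefl _) (erefl _).
rewrite mem_pblock_tabloid_of /same_brick eqxx /= /brick_start {1}/cut /= => ->.
rewrite -[RHS]/(cut (D i) k.+1) /ccol /=; case: ifP => cutk; last by rewrite eqxx.
by rewrite ltn_eqF // ltnS st_le.
Qed.

Lemma card_pblock_tabloid_of D c :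
  #|pblock (tabloid_of D) c| =
  len (cut (D (tag c))) (row_len (tag c)) (brick_start D c).
Proof.
rewrite -sum1_card; under eq_bigl do rewrite mem_pblock_tabloid_of.
transitivity (\sum_(p : {i : 'I_(size la) & 'I_(row_len i)}
    | (tag p == tag c) && (brick_start D p == brick_start D c)) 1)%N.
  by apply: eq_bigl => p; congr (_ && _); apply: eq_sym.
rewrite -(sig_big_dep (fun i => i == tag c)
  (fun i (j : 'I_(row_len i)) => st (cut (D i)) j == brick_start D c) (fun _ _ => 1%N)).
by rewrite big_pred1_eq sum1_card /len -sum1_card [LHS]big_mkcond.
Qed.

(** Naming each brick by its first cell allows products over bricks to be reindexed by cuts. *)
Lemma tabloid_of_imset D :
  tabloid_of D = [set pblock (tabloid_of D) c | c : cell & cut (D (tag c)) (tagged c)].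
Proof.
have /and3P[/eqP covD tiD n0D] := tabloid_of_partition D.
apply/setP => B; apply/idP/imsetP => [BD|[c _ ->]]; last first.
  by rewrite pblock_mem // covD inE.
have /set0Pn[c cB] : B != set0 by apply: contraNneq n0D => <-.
rewrite -(def_pblock tiD BD cB).
have lt_s : (brick_start D c < row_len (tag c))%N.
  exact: leq_ltn_trans (st_le _ _) (ccol_lt c).
exists (mkcell lt_s); first by rewrite inE /= st_cut.
apply/esym/same_pblock => //; rewrite mem_pblock_tabloid_of /same_brick /= eqxx /=.
by rewrite {2}/brick_start /ccol /= st_fix // st_cut.
Qed.

Lemma big_tabloid_of (R : comPzSemiRingType) (h : nat -> R) D :
  \prod_(B in tabloid_of D) h #|B| =
  \prod_(i < size la) \prod_(a < row_len i | cut (D i) a) h (len (cut (D i)) (row_len i) a).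
Proof.
rewrite (sig_big_dep predT (fun (i : 'I_(size la)) (a : 'I_(row_len i)) => cut (D i) a)
  (fun i (a : 'I_(row_len i)) => h (len (cut (D i)) (row_len i) a))).
rewrite tabloid_of_imset big_imset /=; last first.
  move=> c c'; rewrite !inE => cutc cutc' eqB.
  have : c' \in pblock (tabloid_of D) c by rewrite eqB mem_pblock_tabloid_of /same_brick !eqxx.
  rewrite mem_pblock_tabloid_of /same_brick /brick_start !st_fix //.
  by case/andP=> /eqP eqt /eqP eqc; apply: cell_inj.
apply: eq_big => [c|c]; rewrite inE // => cutc.
by rewrite card_pblock_tabloid_of /brick_start st_fix.
Qed.

Lemma last_prod_tabloid_of D :
  last_prod (tabloid_of D) =
  (\prod_(i < size la) len (cut (D i)) (row_len i) (st (cut (D i)) (row_len i).-1))%N.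
Proof.
rewrite /last_prod; under eq_bigr do rewrite card_pblock_tabloid_of.
rewrite -(sig_big_dep predT (fun (i : 'I_(size la)) (a : 'I_(row_len i)) => a.+1 == row_len i)
  (fun i (a : 'I_(row_len i)) => len (cut (D i)) (row_len i) (st (cut (D i)) a))).
apply: eq_bigr => i _; have lt_i : ((row_len i).-1 < row_len i)%N.
  by rewrite prednK // row_len_gt0.
rewrite (big_pred1 (Ordinal lt_i)) // => a.
by rewrite /= -[in RHS]val_eqE /= -[in RHS]eqSS prednK // row_len_gt0.
Qed.

(** Rows are cut independently of each other, so the sum over tabloids is the expansion of a product
    of row sums, each given by [row_sum]. *)
Lemma sum_tabloids (R : comPzRingType) (h p : nat -> R) :
    (forall d, (0 < d)%N ->
       p d = h d *+ d + \sum_(1 <= j < d) h j * p (d - j)%N) ->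
  \sum_(T in tabloids) (\prod_(B in T) h #|B|) *+ last_prod T = \prod_(d <- la) p d.
Proof.
move=> p_rec; rewrite (big_nth 0%N) big_mkord.
transitivity (\prod_(i < size la) \sum_(t : (row_len i).-1.-tuple bool)
    (\prod_(a < row_len i | cut t a) h (len (cut t) (row_len i) a))
      *+ len (cut t) (row_len i) (st (cut t) (row_len i).-1)); last first.
  by apply: eq_bigr => i _; apply: row_sum => //; apply: row_len_gt0.
rewrite (bigA_distr_dffun (fun _ _ => true)
  (fun (i : 'I_(size la)) (t : (row_len i).-1.-tuple bool) =>
  (\prod_(a < row_len i | cut t a) h (len (cut t) (row_len i) a))
    *+ len (cut t) (row_len i) (st (cut t) (row_len i).-1))).
rewrite (reindex_onto tabloid_of cuts_of) => [|T TT]; last exact: cuts_ofK.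
apply: eq_big => [D|D _].
  by rewrite tabloid_of_brick tabloid_ofK eqxx; apply/esym/forallP.
rewrite big_tabloid_of last_prod_tabloid_of -mulr_natr natr_prod -big_split.
by apply: eq_bigr => i _; rewrite /= mulr_natr.
Qed.

End Tabloids.

(** * Expansion of P over the types *)

Lemma typ_is_part n (rho : typ n) i : is_part (tpart rho i).
Proof. by have /andP[/forallP/(_ i)] := valP rho. Qed.

Lemma typ_pos n (rho : typ n) i : 0%N \notin tpart rho i.
Proof. by have /andP[] := typ_is_part rho i. Qed.

Lemma typ_sum n (rho : typ n) : (\sum_(i < n) i.+1 * sumn (tpart rho i) = n)%N.
Proof. by have /andP[_ /eqP] := valP rho. Qed.

Lemma typ_inj n (rho tau : typ n) :
  (forall i, perm_eq (tpart rho i) (tpart tau i)) -> rho = tau.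
Proof.
move=> eq_rt; apply/val_inj/ffunP => i; apply/val_inj/(inj_map val_inj).
have geq_trans : transitive geq by move=> x y z /= yx zy; apply: leq_trans zy yx.
have geq_anti : antisymmetric geq by move=> x y; rewrite andbC => /anti_leq.
apply: (sorted_eq geq_trans geq_anti) (eq_rt i).
  by have /andP[] := typ_is_part rho i.
by have /andP[] := typ_is_part tau i.
Qed.

Lemma leq_sumn (s : seq nat) d : d \in s -> (d <= sumn s)%N.
Proof. by move=> sd; rewrite sumnE (big_rem d) //= leq_addr. Qed.

Lemma size_leq_sumn (s : seq nat) : 0%N \notin s -> (size s <= sumn s)%N.
Proof.
elim: s => //= d s IHs; rewrite in_cons negb_or eq_sym -lt0n => /andP[d_gt0 /IHs].
by rewrite -addn1 addnC; apply: leq_add.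
Qed.

(** The weighted sum bounds both the parts and their number by [n], as the finite encoding of types
    demands; sorting supplies the order. *)
Lemma ex_typ n (f : 'I_n -> seq nat) :
    (forall i, 0%N \notin f i) -> (\sum_(i < n) i.+1 * sumn (f i) = n)%N ->
  exists rho : typ n, forall i, perm_eq (tpart rho i) (f i).
Proof.
move=> f_pos f_sum.
have sumn_le i : (sumn (f i) <= n)%N.
  by rewrite -[leqRHS]f_sum (bigD1 i) //= (leq_trans (leq_pmull _ (ltn0Sn i))) ?leq_addr.
have sizeP i : (size [seq inord d : 'I_n.+1 | d <- sort geq (f i)] <= n)%N.
  by rewrite size_map size_sort (leq_trans (size_leq_sumn (f_pos i))).
pose t := [ffun i => Bseq (sizeP i)].
have tE i : map val (t i) = sort geq (f i).
  rewrite ffunE /= -map_comp -[RHS]map_id; apply/eq_in_map => d.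
  rewrite mem_sort => fd; rewrite /= inordK // ltnS.
  exact: leq_trans (leq_sumn fd) (sumn_le i).
have t_type : is_type t.
  apply/andP; split.
    apply/forallP => i; rewrite tE /is_part mem_sort f_pos andbT.
    by apply: sort_sorted => x y; apply: leq_total.
  apply/eqP; rewrite -[RHS]f_sum; apply: eq_bigr => i _; rewrite tE.
  by rewrite (perm_sumn (permEl (perm_sort geq (f i)))).
exists (exist _ t t_type) => i; rewrite /tpart /= tE.
by apply/permPl/perm_sort.
Qed.

Lemma card_cell la : #|cell la| = sumn la.
Proof.
rewrite card_tagged sumnE big_map big_enum sumnE (big_nth 0%N) big_mkord.
by apply: eq_bigr => i _; rewrite card_ord.
Qed.

Lemma mem_brick_tabloids la mu T :
  (T \in brick_tabloids la mu) =
  (T \in tabloids la) && perm_eq [seq #|pred_of_set B| | B in T] mu.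
Proof. by rewrite !inE andbA. Qed.

Lemma sumn_tabloid la T : T \in tabloids la ->
  sumn [seq #|pred_of_set B| | B in T] = sumn la.
Proof.
rewrite inE => /andP[partT _]; rewrite sumnE big_map big_enum.
by rewrite -[LHS](card_partition partT) cardsT; apply: card_cell.
Qed.

Lemma tabloid_pos la T : T \in tabloids la ->
  0%N \notin [seq #|pred_of_set B| | B in T].
Proof.
rewrite inE => /andP[/and3P[_ _ n0T] _]; apply/imageP => -[B BT /esym/eqP].
by rewrite cards_eq0 => /eqP B0; rewrite -B0 BT in n0T.
Qed.

(** A family of tabloids, one for each multiplicity, has exactly one content [rho], so summing over
    [rho] and then over its tabloids is summing over all families. The sequences [h] and [p] depend
    on [i] to allow for the substitution attached to each multiplicity. *)
Lemma sum_polybrick (R : comPzRingType) n (sigma : typ n) (h p : 'I_n -> nat -> R) :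
    (forall i d, (0 < d)%N ->
       p i d = h i d *+ d + \sum_(1 <= j < d) h i j * p i (d - j)%N) ->
  \prod_(i < n) \prod_(d <- tpart sigma i) p i d =
  \sum_(rho : typ n) \sum_(T in simple_polybrick_tabloids sigma rho)
     (\prod_(i < n) \prod_(d <- tpart rho i) h i d) *+ poly_last_prod T.
Proof.
move=> p_rec.
transitivity (\prod_(i < n) \sum_(T in tabloids (tpart sigma i))
    (\prod_(B in T) h i #|B|) *+ last_prod T).
  by apply: eq_bigr => i _; rewrite (sum_tabloids (typ_pos sigma i) (p_rec i)).
rewrite (bigA_distr_dffun (fun i => mem (tabloids (tpart sigma i)))
  (fun i T => (\prod_(B in T) h i #|B|) *+ last_prod T)).
rewrite (exchange_big_dep predT) //= [LHS]big_mkcond; apply: eq_bigr => T _.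
have mem_spt rho : (T \in simple_polybrick_tabloids sigma rho) =
    [forall i, T i \in tabloids (tpart sigma i)] &&
    [forall i, perm_eq [seq #|pred_of_set B| | B in T i] (tpart rho i)].
  rewrite in_setXn; apply/forallP/andP => [TP|[/forallP TP /forallP cT] i].
    by split; apply/forallP => i; have := TP i; rewrite mem_brick_tabloids => /andP[].
  by rewrite mem_brick_tabloids TP cT.
under [RHS]eq_bigl do rewrite mem_spt.
case: forallP => [TP|_]; last by rewrite big_pred0.
(* The brick lengths are positive and have the same sum as the rows of [sigma], so they do form a
   type of [n]. *)
have [||rho rhoP] := @ex_typ n (fun i => [seq #|pred_of_set B| | B in T i]).
- by move=> i; apply: tabloid_pos (TP i).
- by rewrite -[RHS](typ_sum sigma); apply: eq_bigr => i _; rewrite (sumn_tabloid (TP i)).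
rewrite (big_pred1 rho) => [|tau]; last first.
  apply/forallP/eqP => [tauP|-> i]; last by rewrite perm_sym.
  by apply: typ_inj => i; rewrite perm_sym (permPl (rhoP i)).
transitivity (\prod_i \prod_(d <- [seq #|pred_of_set B| | B in T i]) h i d
    *+ poly_last_prod T); last first.
  by congr (_ *+ _); apply: eq_bigr => i _; rewrite (perm_big _ (rhoP i)).
rewrite -mulr_natr natr_prod -big_split; apply: eq_bigr => i _ /=.
by rewrite mulr_natr big_map big_enum.
Qed.

(** * Signs, and the recurrences for P in terms of H and E *)

Lemma prodrN_seq (R : comPzRingType) I (s : seq I) (F : I -> R) :
  \prod_(d <- s) - F d = (-1) ^+ size s * \prod_(d <- s) F d.
Proof.
elim: s => [|d s IHs]; first by rewrite !big_nil mul1r.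
by rewrite !big_cons IHs /= exprS mulN1r !mulNr mulrCA.
Qed.

Lemma prodrN_typ (R : comPzRingType) n (rho : typ n) (F : 'I_n -> nat -> R) :
  \prod_(i < n) \prod_(d <- tpart rho i) - F i d =
  (-1) ^+ tlen rho * \prod_(i < n) \prod_(d <- tpart rho i) F i d.
Proof.
rewrite (big_morph _ (fun a b => exprD (-1) a b) (expr0 _)) -big_split.
by apply: eq_bigr => i _; apply: prodrN_seq.
Qed.

Lemma sertypE F n (rho : typ n) :
  sertyp F rho = \prod_(i < n) \prod_(d <- tpart rho i) spow_subst i.+1 (F d).
Proof. by []. Qed.

Lemma series_sign k (f : series) m : ((-1) ^+ k * f) m = (-1) ^+ k * f m.
Proof.
elim: k => [|k IHk]; first by rewrite !expr0 mul1r mul1r.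
by rewrite !exprS !mulN1r !mulNr seriesN IHk.
Qed.

Lemma Hser0 : Hser 0 = 1.
Proof. by apply: boolp.funext => m; rewrite /Hser wdeg_eq0. Qed.

Lemma Eser0 : Eser 0 = 1.
Proof.
apply: boolp.funext => m; rewrite /Eser wdeg_eq0.
rewrite [RHS](_ : _ = (m == mone)%:R) //; case: eqP => //= ->.
by rewrite /squarefree mdom1 cardfs0 expr0; case: allP => // [[]].
Qed.

Lemma newton_split (R : comPzRingType) (P F : nat -> R) d : F 0%N = 1 ->
  \sum_(1 <= k < d.+2) P k * F (d.+1 - k)%N =
  P d.+1 + \sum_(1 <= j < d.+1) F j * P (d.+1 - j)%N.
Proof.
move=> F0; rewrite big_nat_recr //= subnn F0 mulr1 addrC big_nat_rev /=.
congr (_ + _); apply: eq_big_nat => j /andP[_ lt_jd].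
by rewrite add1n subSS mulrC subKn // ltnW.
Qed.

Lemma Pser_rec_H d : (0 < d)%N ->
  - Pser d = - Hser d *+ d + \sum_(1 <= j < d) - Hser j * - Pser (d - j)%N.
Proof.
case: d => // d _; under eq_bigr do rewrite mulrNN.
by rewrite mulNrn newton_H (newton_split Pser d Hser0) opprD addrNK.
Qed.

Lemma Pser_rec_E d : (0 < d)%N ->
  Pser d = - Eser d *+ d + \sum_(1 <= j < d) - Eser j * Pser (d - j)%N.
Proof.
case: d => // d _; under eq_bigr do rewrite mulNr.
by rewrite sumrN mulNrn newton_E opprK (newton_split Pser d Eser0) addrK.
Qed.

Lemma rmorph_rec (R S : comPzRingType) (f : {rmorphism R -> S}) (h p : nat -> R) d :
    p d = - h d *+ d + \sum_(1 <= j < d) - h j * p (d - j)%N ->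
  f (p d) = - f (h d) *+ d + \sum_(1 <= j < d) - f (h j) * f (p (d - j)%N).
Proof.
move=> {1}->; rewrite rmorphD rmorphMn rmorphN rmorph_sum; congr (_ + _).
by apply: eq_bigr => j _; rewrite rmorphM rmorphN.
Qed.

Lemma rmorph_recN (R S : comPzRingType) (f : {rmorphism R -> S}) (h p : nat -> R) d :
    - p d = - h d *+ d + \sum_(1 <= j < d) - h j * - p (d - j)%N ->
  - f (p d) = - f (h d) *+ d + \sum_(1 <= j < d) - f (h j) * - f (p (d - j)%N).
Proof.
move=> p_rec; rewrite -rmorphN (rmorph_rec (p := fun d => - p d) f p_rec).
by congr (_ + _); apply: eq_bigr => j _; rewrite rmorphN.
Qed.

Lemma expansion_E n (sigma : typ n) :
  is_expansion (fun rho : typ n => sertyp Eser rho) (sertyp Pser sigma)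
    [ffun rho => \sum_(T in simple_polybrick_tabloids sigma rho)
       (-1) ^+ tlen rho * (poly_last_prod T)%:R].
Proof.
move=> m; rewrite sertypE.
rewrite (@sum_polybrick _ _ _ (fun i d => - spow_subst i.+1 (Eser d))) => [|i d d_gt0].
  rewrite series_sum; apply: eq_bigr => rho _; rewrite ffunE mulr_suml series_sum.
  apply: eq_bigr => T _; rewrite series_mulrn prodrN_typ series_sign.
  by rewrite -[LHS]mulr_natr mulrAC.
exact: rmorph_rec (Pser_rec_E d_gt0).
Qed.

Lemma sign_subz (a b : nat) : (-1 : rat) ^ (a%:Z - b%:Z) = (-1) ^+ b * (-1) ^+ a.
Proof. by rewrite expfzDr ?oppr_eq0 ?oner_eq0 // mulrC -exprnN invr_sign. Qed.

Lemma expansion_H n (sigma : typ n) :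
  is_expansion (fun rho : typ n => sertyp Hser rho) (sertyp Pser sigma)
    [ffun rho => \sum_(T in simple_polybrick_tabloids sigma rho)
       (-1) ^ ((tlen rho)%:Z - (tlen sigma)%:Z) * (poly_last_prod T)%:R].
Proof.
move=> m; have := @sum_polybrick _ _ sigma (fun i d => - spow_subst i.+1 (Hser d))
  (fun i d => - spow_subst i.+1 (Pser d)).
rewrite (prodrN_typ sigma (fun i d => spow_subst i.+1 (Pser d))) -sertypE => expP.
(* The sign of [sigma] is inserted twice: one copy turns the factors [P] into [- P], to which the
   recurrence applies, the other gives the sign in the result. *)
rewrite -[sertyp Pser sigma](signrMK (tlen sigma)) series_sign expP => [|i d d_gt0].
  rewrite series_sum mulr_sumr; apply: eq_bigr => rho _.
  rewrite ffunE mulr_suml series_sum mulr_sumr; apply: eq_bigr => T _.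
  rewrite series_mulrn (prodrN_typ rho (fun i d => spow_subst i.+1 (Hser d))).
  rewrite series_sign sign_subz -sertypE.
  by move: (sertyp Hser rho m) => x; rewrite -[_ *+ _]mulr_natr !mulrA mulrAC.
exact: rmorph_recN (Pser_rec_H d_gt0).
Qed.

(** * Freeness *)

Definition blocks n (rho : typ n) : seq (nat * nat) :=
  [seq (d, i.+1) | i : 'I_n <- index_enum 'I_n, d <- tpart rho i].

Lemma big_blocks (S : Type) (idx : S) (op : Monoid.law idx) n (rho : typ n)
    (F : nat * nat -> S) :
  \big[op/idx]_(b <- blocks rho) F b =
  \big[op/idx]_(i < n) \big[op/idx]_(d <- tpart rho i) F (d, i.+1).
Proof. by rewrite big_allpairs_dep. Qed.

Lemma size_blocks n (rho : typ n) : size (blocks rho) = tlen rho.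
Proof.
rewrite -sum1_size big_blocks; apply: eq_bigr => i _; exact: sum1_size.
Qed.

Lemma blocks_inj n (rho tau : typ n) : perm_eq (blocks rho) (blocks tau) -> rho = tau.
Proof.
move=> eq_rt; apply: typ_inj => i; apply/permP => a.
have cnt (mu : typ n) :
    count [pred b : nat * nat | a b.1 && (b.2 == i.+1)] (blocks mu) = count a (tpart mu i).
  rewrite -sum1_count big_mkcond big_blocks (bigD1 i) //= [X in (_ + X)%N]big1 => [|j ne_ji].
    rewrite addn0 -sum1_count [RHS]big_mkcond /=.
    by apply: eq_bigr => d _; rewrite eqxx andbT.
  by rewrite big1 // => d _; rewrite /= eqSS [nat_of_ord j == i]val_eqE (negbTE ne_ji) andbF.
by rewrite -!cnt; move/permP: eq_rt; apply.
Qed.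

Lemma blocks_pos n (rho : typ n) b : b \in blocks rho -> (0 < b.1)%N && (0 < b.2)%N.
Proof.
case/allpairsPdep => i [d [_ di ->]] /=; rewrite andbT lt0n.
by apply: contraTneq di => ->; apply: typ_pos.
Qed.

Definition pows (s : seq (var * nat)) : monom :=
  \big[mmul/mone]_(v <- s) expcmn (ucm v.1) v.2.

Lemma pows_cons v s : pows (v :: s) = mmul (expcmn (ucm v.1) v.2) (pows s).
Proof. exact: big_cons. Qed.

Lemma powsE s x : pows s x = (\sum_(v <- s | v.1 == x) v.2)%N.
Proof.
elim: s => [|v s IHs]; first by rewrite /pows !big_nil cm1.
rewrite pows_cons cmM IHs big_cons expcmE cmU.
by case: eqP => _; rewrite ?muln1 ?muln0.
Qed.

Lemma pows_gt0 s x : (0 < pows s x)%N -> x \in unzip1 s.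
Proof.
rewrite powsE; apply: contraLR => xs; rewrite -eqn0Ngt big1_seq // => v /andP[/eqP eqx vs].
by rewrite -eqx map_f in xs.
Qed.

Lemma pows_uniq s v : uniq (unzip1 s) -> v \in s -> pows s v.1 = v.2.
Proof.
rewrite powsE; elim: s => //= w s IHs /andP[ws s_uniq]; rewrite in_cons big_cons.
case/predU1P=> [->|vs].
  rewrite eqxx big1_seq ?addn0 // => u /andP[/eqP eq_u us].
  by rewrite -eq_u map_f in ws.
case: eqP => [eq_wv|_]; last exact: IHs.
by rewrite eq_wv map_f in ws.
Qed.

(** Every variable of [s] really occurs in the monomial, hence also in [t]. When the sizes agree,
    the variables of [t] are distinct too, and the exponents can be compared one by one. *)
Lemma pows_eq s t : uniq (unzip1 s) -> {in s, forall v, (0 < v.2)%N} ->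
  pows s = pows t -> (size s <= size t)%N /\ (size t = size s -> perm_eq s t).
Proof.
move=> s_uniq s_pos eq_st.
have sub : {subset unzip1 s <= unzip1 t}.
  by move=> _ /mapP[v vs ->]; apply: pows_gt0; rewrite -eq_st pows_uniq // s_pos.
split; first by rewrite -[size s](size_map fst) -[size t](size_map fst) uniq_leq_size.
move=> eq_size; have t_uniq : uniq (unzip1 t).
  by apply: leq_size_uniq s_uniq sub _; rewrite !size_map eq_size.
rewrite perm_sym; apply: uniq_perm; [exact: map_uniq t_uniq | exact: map_uniq s_uniq|].
have sub_st : {subset s <= t}.
  move=> v vs; have /mapP[w wt eq_vw] : v.1 \in unzip1 t by apply/sub/map_f.
  suff -> : v = w by [].
  rewrite [v]surjective_pairing [w]surjective_pairing eq_vw; congr pair.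
  by rewrite -(pows_uniq s_uniq vs) -(pows_uniq t_uniq wt) eq_st eq_vw.
have [] := uniq_min_size (map_uniq s_uniq) sub_st; first by rewrite eq_size.
by move=> _ eq_mem v; rewrite eq_mem.
Qed.

(* Necessary for the power [v.1 ^ v.2] of a variable to be a term of the factor
   [P_{d^r}] of the block [b = (d, r)]. *)
Definition block_of_pow (b : nat * nat) (v : var * nat) : bool :=
  (vdeg v.1 * v.2 == b.1 * b.2)%N && (vdeg v.1 <= b.1)%N.

Lemma spow_P_supp b m : (0 < b.1)%N -> (0 < b.2)%N ->
    spow_subst b.2 (Pser b.1) m != 0 ->
  exists2 v, block_of_pow b v & m = expcmn (ucm v.1) v.2.
Proof.
case: b => d [//|r] /= d_gt0 _.
have [[a <-]|nexp] := boolp.EM (exists a : monom, expcmn a r.+1 = m); last first.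
  by rewrite spow_subst_nexp ?eqxx // => a; apply/eqP => eqa; apply: nexp; exists a.
rewrite spow_subst_exp PserE //; case: (wdeg a =P d) => [wa|_]; last by rewrite eqxx.
have [[x [xa eqa]]|nx] :=
    boolp.EM (exists x, x \in finsupp a /\ a = expcmn (ucm x) (a x)).
  move=> _; exists (x, (r.+1 * a x)%N).
    have wax : wdeg a = (vdeg x * a x)%N by rewrite {1}eqa wdeg_pow.
    rewrite /block_of_pow /= mulnCA -wa wax mulnC eqxx /=.
    by rewrite leq_pmulr // lt0n cmE_neq0.
  by apply/eqP/cmP=> y; rewrite expcmE {1}eqa !expcmE mulnA.
rewrite /Pcoef big1_seq ?eqxx // => x /andP[_ xa].
by case: eqP => // eqa; case: nx; exists x.
Qed.

Lemma prod_P_supp bl m : {in bl, forall b, (0 < b.1)%N && (0 < b.2)%N} ->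
    (\prod_(b <- bl) spow_subst b.2 (Pser b.1)) m != 0 ->
  exists2 s, all2 block_of_pow bl s & m = pows s.
Proof.
elim: bl m => [|b bl IHbl] m bl_pos.
  rewrite big_nil; case: (eqVneq m mone) => [->|/negbTE nm1].
    by exists [::]; rewrite // /pows big_nil.
  by rewrite [X in X != 0](_ : _ = (m == mone)%:R) // nm1 eqxx.
rewrite big_cons seriesM => nz.
have [a am nza] : exists2 a, a \in mdivs m &
    spow_subst b.2 (Pser b.1) a
      * (\prod_(b <- bl) spow_subst b.2 (Pser b.1)) (divcm m a) != 0.
  apply/hasP; apply: contraNT nz => /hasPn nz; rewrite big1_seq // => a /nz.
  by rewrite negbK => /eqP.
move: nza; rewrite mulf_eq0 negb_or => /andP[nzb nzbl].
have /andP[b1 b2] := bl_pos b (mem_head b bl).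
have [v bv av] := spow_P_supp b1 b2 nzb.
have [|s bls eqs] := IHbl (divcm m a) _ nzbl.
  by move=> c cbl; apply: bl_pos; rewrite in_cons cbl orbT.
by exists (v :: s); rewrite /= ?bv // pows_cons -av -eqs divcmK.
Qed.

(** The degrees are compared term by term, so equal sums force equality in each term; as
    [vdeg v.1 * v.2 = b.1 * b.2], the exponents then equal the multiplicities. *)
Lemma all2_block_of_pow bl s : {in bl, forall b, (0 < b.1)%N} ->
    all2 block_of_pow bl s ->
  [/\ size s = size bl,
      (\sum_(v <- s) vdeg v.1 <= \sum_(b <- bl) b.1)%N &
      (\sum_(v <- s) vdeg v.1 = \sum_(b <- bl) b.1)%N ->
        [seq (vdeg v.1, v.2) | v <- s] = bl].
Proof.
elim: bl s => [|b bl IHbl] [|v s] //= bl_pos.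
  by rewrite !big_nil.
have b_gt0 := bl_pos b (mem_head b bl).
case/andP=> /andP[/eqP eq_bv le_vb] /IHbl[|-> le_sum eq_sum].
  by move=> c cbl; apply: bl_pos; rewrite in_cons cbl orbT.
rewrite !big_cons; split=> //; first exact: leq_add.
move=> eq_sums; have eq_b : vdeg v.1 = b.1.
  apply/eqP; rewrite eqn_leq le_vb -(leq_add2r (\sum_(c <- bl) c.1)) -eq_sums.
  by rewrite leq_add2l.
rewrite eq_sum; last by move/eqP: eq_sums; rewrite eq_b eqn_add2l => /eqP.
congr (_ :: _); rewrite [RHS]surjective_pairing eq_b; congr pair.
by apply/eqP; rewrite -(eqn_pmul2l b_gt0) -eq_bv eq_b.
Qed.

(** The position of a block in the list serves as the second index of its variable, which makes all
    variables distinct even for repeated blocks. *)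
Definition typ_pows n (rho : typ n) : seq (var * nat) :=
  [seq ((p.1.1.-1, p.2), p.1.2) | p <- zip (blocks rho) (iota 0 (tlen rho))].

Lemma typ_pows_uniq n (rho : typ n) : uniq (unzip1 (typ_pows rho)).
Proof.
rewrite /unzip1 -map_comp; apply: (@map_uniq _ _ snd); rewrite -map_comp.
rewrite (@eq_map _ _ _ snd) // -/(unzip2 _) unzip2_zip ?iota_uniq //.
by rewrite size_blocks size_iota.
Qed.

Lemma typ_pows_blocks n (rho : typ n) :
  [seq (vdeg v.1, v.2) | v <- typ_pows rho] = blocks rho.
Proof.
rewrite -map_comp -[RHS](@unzip1_zip _ _ _ (iota 0 (tlen rho))); last first.
  by rewrite size_blocks size_iota.
apply/eq_in_map => -[[d r] j] /(map_f fst); rewrite -/(unzip1 _) unzip1_zip; last first.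
  by rewrite size_blocks size_iota.
by move/blocks_pos => /andP[/= d_gt0 _]; rewrite /vdeg /= prednK.
Qed.

Lemma typ_pows_pos n (rho : typ n) : {in typ_pows rho, forall v, (0 < v.2)%N}.
Proof.
move=> v /(map_f (fun v => (vdeg v.1, v.2))); rewrite typ_pows_blocks => /blocks_pos.
by case/andP.
Qed.

(** Lexicographic order on number of blocks and sum of degrees, encoded by one number: the sum is at
    most [n], so the factor [n.+1] keeps the two apart. *)
Definition typ_rank n (rho : typ n) : nat :=
  (tlen rho * n.+1 + \sum_(b <- blocks rho) b.1)%N.

Lemma sum_blocks_le n (rho : typ n) : (\sum_(b <- blocks rho) b.1 <= n)%N.
Proof.
rewrite big_blocks -[leqRHS](typ_sum rho); apply: leq_sum => i _ /=.
by rewrite sumnE leq_pmull.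
Qed.

Lemma sertyp_blocks n (rho : typ n) :
  sertyp Pser rho = \prod_(b <- blocks rho) spow_subst b.2 (Pser b.1).
Proof. by rewrite big_blocks. Qed.

(** Each block of [rho] supplies one power of a variable, and the monomial of [sigma] needs
    [tlen sigma] distinct variables. If the numbers agree, the powers are those of [sigma], and
    [all2_block_of_pow] compares the degrees. *)
Lemma sertyp_P_triangular n (rho sigma : typ n) :
    sertyp Pser rho (pows (typ_pows sigma)) != 0 ->
  rho = sigma \/ (typ_rank sigma < typ_rank rho)%N.
Proof.
rewrite sertyp_blocks => /prod_P_supp[|s bl_s eq_pows]; first exact: blocks_pos.
have [|size_s le_sum eq_sum] := all2_block_of_pow _ bl_s.
  by move=> b /blocks_pos /andP[].
have [] := pows_eq (typ_pows_uniq sigma) (@typ_pows_pos _ sigma) eq_pows.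
have size_sigma : size (typ_pows sigma) = tlen sigma.
  by rewrite -size_blocks -typ_pows_blocks size_map.
rewrite size_s size_blocks size_sigma leq_eqVlt => /predU1P[eq_len|lt_len _]; last first.
  right; rewrite /typ_rank -addnS -[X in (_ <= X)%N]addn0.
  apply: leq_trans (leq_add (leqnn _) (_ : _ <= n.+1)%N) _; first by rewrite ltnS sum_blocks_le.
  by rewrite -mulSnr addn0 (leq_trans _ (leq_addr _ _)) // leq_mul2r lt_len orbT.
rewrite eq_len => /(_ erefl) perm_s.
have sum_sigma : (\sum_(v <- s) vdeg v.1 = \sum_(b <- blocks sigma) b.1)%N.
  by rewrite -typ_pows_blocks big_map -(perm_big _ perm_s).
rewrite sum_sigma in le_sum eq_sum.
move: le_sum; rewrite leq_eqVlt => /predU1P[/eq_sum eq_bl|lt_sum].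
  left; apply: blocks_inj; rewrite -eq_bl -typ_pows_blocks perm_sym.
  exact: perm_map.
by right; rewrite /typ_rank eq_len ltn_add2l.
Qed.

(** All coefficients are nonnegative, so nothing cancels and one positive contribution suffices. *)
Lemma prod_series_gt0 (T : eqType) (s : seq T) (F : T -> series) (a : T -> monom) :
    (forall t m, 0 <= F t m) -> {in s, forall t, 0 < F t (a t)} ->
  0 < (\prod_(t <- s) F t) (\big[mmul/mone]_(t <- s) a t).
Proof.
move=> F_ge0; have prod_ge0 r m : 0 <= (\prod_(t <- r) F t) m.
  elim: r m => [|t r IHr] m; first by rewrite big_nil; apply: ler0n.
  by rewrite big_cons seriesM; apply: sumr_ge0 => b _; rewrite mulr_ge0.
elim: s => [|t s IHs] s_pos.
  by rewrite !big_nil [ltRHS](_ : _ = (mone == mone :> monom)%:R) // eqxx.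
rewrite !big_cons seriesM (bigD1_seq _ (mem_mdivs_mul _ _) (mdivs_uniq _)) /=.
apply: ltr_wpDr; first by apply: sumr_ge0 => b _; rewrite mulr_ge0.
rewrite mulKcm mulr_gt0 ?s_pos ?mem_head // IHs // => u us.
by rewrite s_pos // in_cons us orbT.
Qed.

Lemma sertyp_P_diag n (rho : typ n) : 0 < sertyp Pser rho (pows (typ_pows rho)).
Proof.
rewrite sertyp_blocks -typ_pows_blocks big_map /pows.
apply: prod_series_gt0 => [v m|v rho_v].
  apply: sumr_ge0 => a _; apply: sumr_ge0 => k _; apply: sumr_ge0 => x _.
  by case: ifP.
have := typ_pows_pos rho_v; case: v {rho_v} => x [//|r] _ /=.
rewrite spow_subst_exp PserE //.
have wx : wdeg (ucm x) = vdeg x by have := wdeg_pow x 1; rewrite muln1.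
rewrite wx eqxx /Pcoef mdomU big_seq_fset1 cmUU eqxx.
by rewrite ltr0n.
Qed.

Lemma sertyp_P_free n (c : typ n -> rat) :
  (forall m, \sum_rho c rho * sertyp Pser rho m = 0) -> forall rho, c rho = 0.
Proof.
move=> c0 rho0; apply/eqP/negPn/negP => nz0.
(* By triangularity, the monomial of a type of maximal rank among those with nonzero coefficient
   occurs in no other term of the relation. *)
have [sigma nz_sigma max_sigma] := @arg_maxnP _ rho0 (fun rho => c rho != 0)
  (@typ_rank n) nz0.
have := c0 (pows (typ_pows sigma)); rewrite (bigD1 sigma) //= big1 => [/eqP|rho ne_rs].
  by rewrite addr0 mulf_eq0 (negbTE nz_sigma) gt_eqF // sertyp_P_diag.
apply/eqP; rewrite mulf_eq0 -[_ || _]negbK negb_or; apply/negP => /andP[nz_rho].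
case/sertyp_P_triangular=> [eq_rs|]; first by rewrite eq_rs eqxx in ne_rs.
by rewrite ltnNge; apply/negP/negPn/max_sigma.
Qed.

(* A family through which the basis [P] expands is itself free: the square matrix of
   the expansions is injective, hence invertible. *)
Lemma free_of_expansions n (B : typ n -> series) (C : typ n -> {ffun typ n -> rat})
    (c : {ffun typ n -> rat}) :
    (forall sigma, is_expansion B (sertyp Pser sigma) (C sigma)) ->
    (forall m, \sum_rho c rho * B rho m = 0) ->
  forall rho, c rho = 0.
Proof.
move=> expC c0.
pose A := \matrix_(i < #|typ n|, j < #|typ n|) C (enum_val i) (enum_val j).
have sum_A (v : 'rV[rat]_#|typ n|) m :
    \sum_sigma v 0 (enum_rank sigma) * sertyp Pser sigma m =
    \sum_rho (v *m A) 0 (enum_rank rho) * B rho m.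
  under eq_bigr do rewrite expC mulr_sumr.
  rewrite exchange_big; apply: eq_bigr => rho _; rewrite mxE mulr_suml.
  rewrite (reindex (@enum_rank (typ n))); last exact/onW_bij/enum_rank_bij.
  by apply: eq_bigr => sigma _; rewrite mxE !enum_rankK mulrA.
have freeP (v : 'rV[rat]_#|typ n|) :
    (forall m, \sum_rho (v *m A) 0 (enum_rank rho) * B rho m = 0) -> v = 0.
  move=> v0; apply/rowP => i; rewrite mxE -[i]enum_valK.
  apply: (sertyp_P_free (c := fun sigma => v 0 (enum_rank sigma))) => m.
  by rewrite sum_A.
have unitA : A \in unitmx.
  rewrite -row_free_unit; apply: inj_row_free => v vA; apply: freeP => m.
  by rewrite vA big1 // => rho _; rewrite mxE mul0r.
pose v := \row_(i < #|typ n|) c (enum_val i).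
(* Multiplication by the inverse matrix turns the relation among the [B rho] into one among the
   [P_sigma], which are free. *)
have : v *m invmx A = 0.
  apply: freeP => m; rewrite mulmxKV // -[RHS](c0 m).
  by apply: eq_bigr => rho _; rewrite mxE enum_rankK.
move/(congr1 (mulmx^~ A)); rewrite mulmxKV // mul0mx => v0 rho.
by have := congr1 (fun w : 'rV_ _ => w 0 (enum_rank rho)) v0; rewrite !mxE enum_rankK.
Qed.

Lemma is_coef_expansions n (B : typ n -> series) (C : typ n -> {ffun typ n -> rat}) :
    (forall sigma, is_expansion B (sertyp Pser sigma) (C sigma)) ->
  forall sigma tau, is_coef B (sertyp Pser sigma) tau (C sigma tau).
Proof.
move=> expC sigma tau; exists (C sigma) => //; split=> // c expc.
apply/ffunP => rho; apply/eqP; rewrite -subr_eq0; apply/eqP.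
have := @free_of_expansions n B C [ffun rho => C sigma rho - c rho] expC.
move/(_ _ rho); rewrite ffunE; apply=> m.
under eq_bigr do rewrite ffunE mulrBl.
by rewrite sumrB -expC -expc subrr.
Qed.

Theorem theorem37 (n : nat) (sigma tau : typ n) :
  is_coef (fun rho : typ n => sertyp Hser rho) (sertyp Pser sigma) tau
    (\sum_(T in simple_polybrick_tabloids sigma tau)
       (-1) ^ ((tlen tau)%:Z - (tlen sigma)%:Z) * (poly_last_prod T)%:R)
  /\
  is_coef (fun rho : typ n => sertyp Eser rho) (sertyp Pser sigma) tau
    (\sum_(T in simple_polybrick_tabloids sigma tau)
       (-1) ^+ tlen tau * (poly_last_prod T)%:R).
Proof.
split.
  by have := is_coef_expansions (@expansion_H n) sigma tau; rewrite ffunE.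
by have := is_coef_expansions (@expansion_E n) sigma tau; rewrite ffunE.
Qed.
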